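(* Let $g\ge1$ and fix $(u,B) \in (\mathbb{C}^g \times \mathbb{H}_g) \setminus \Theta_g$. Then the characteristic function of $X_{(u,B)}$ equals $$\phi_{X_{(u,B)}}(v) = \mathbb{E}[e^{iv^t X_{(u,B)}}] = \frac{\theta\left( u + \frac{i}{2\pi }v ,B \right)}{\theta(u,B)} = \frac{1}{\theta} \sum_{a \in \mathbb{N}^g} \frac{i^{|a|}}{(2\pi )^{|a|}}\frac{1}{a!}(D^a_u\theta)\, v^a.$$ Consequently, the moments, central moments ($a\in\mathbb{N}^g$) and cumulants ($a\in\mathbb{N}^g$, $a\neq 0$) are given by $$\mu_{a} [X_{(u,B)}] = \frac{1}{(2\pi )^{|a|}} \frac{1}{\theta} D^a_u\theta,$$ $$m_{a}[X_{(u,B)}] = \frac{1}{(2\pi )^{|a|}} \frac{1}{\theta} \sum_{0\leq b\leq a} \binom{a}{b} \frac{(-1)^{|b|}}{\theta^{|b|}} (D_u \theta)^b D^{a-b}_u\theta,$$ $$\kappa_{a}[X_{(u,B)}] = \frac{1}{(2\pi )^{|a|}} D^a_u(\log \theta),$$ where $\theta$ and its derivatives on the right-hand sides are evaluated at $(u,B)$.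
   Context: Notation: $\mathbf{e}(x)=e^{2\pi x}$. $\mathbb{H}_g=\{B\in\mathbb{C}^{g\times g} : B^t=B,\ \operatorname{Re}B\succ 0\}$. The Riemann theta function is $\theta\colon\mathbb{C}^g\times\mathbb{H}_g\to\mathbb{C}$, $\theta(u,B)=\sum_{n\in\mathbb{Z}^g}\mathbf{e}(-\frac12 n^tBn+n^tu)$, and $\Theta_g=\{(u,B)\in\mathbb{C}^g\times\mathbb{H}_g:\theta(u,B)=0\}$. For $(u,B)\notin\Theta_g$, the (complex) discrete Gaussian distribution with parameters $(u,B)$ is the complex-valued probability distribution on $\mathbb{Z}^g$ given by $p_\theta(n;u,B)=\frac{1}{\theta(u,B)}\mathbf{e}(-\frac12 n^tBn+n^tu)$; $X_{(u,B)}$ denotes a random variable with values in $\mathbb{Z}^g$ and this distribution, and $\mathbb{E}[f(X_{(u,B)})]=\sum_n f(n)p_\theta(n;u,B)$. Multi-indices: $\mathbb{N}=\{0,1,2,\dots\}$; for $a\in\mathbb{N}^g$, $|a|=a_1+\dots+a_g$, $a!=a_1!\cdots a_g!$, $b\le a$ means $b_i\le a_i$ for all $i$, $\binom{a}{b}=\frac{a!}{b!(a-b)!}$, $v^a=v_1^{a_1}\cdots v_g^{a_g}$. For a function $f$ of $u$, $D_u^af=\frac{\partial^{|a|}f}{\partial u_1^{a_1}\cdots\partial u_g^{a_g}}$ and $(D_uf)^a=\left(\frac{\partial f}{\partial u_1}\right)^{a_1}\cdots\left(\frac{\partial f}{\partial u_g}\right)^{a_g}$; $D_u^a(\log f)$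 ($a\ne0$) denotes the higher logarithmic derivative, obtained by formally differentiating $\log f$ (e.g. $D^1_u\log f=f'/f$, $D^2_u\log f=(ff''-f'^2)/f^2$ in one variable). For a random variable $X=(X_1,\dots,X_g)$ with mean vector $\mu=(\mu_1,\dots,\mu_g)^t$, $\mu_i=\mathbb{E}[X_i]$: $\mu_a[X]=\mathbb{E}[X_1^{a_1}\cdots X_g^{a_g}]$, $m_a[X]=\mathbb{E}[(X_1-\mu_1)^{a_1}\cdots(X_g-\mu_g)^{a_g}]$, the characteristic function is the formal power series $\phi_X(v)=\mathbb{E}[e^{iv^tX}]=\sum_a\frac{i^{|a|}}{a!}\mu_a[X]v^a$, and the cumulants are defined by $\sum_a\frac{\kappa_a[X]}{a!}v^a=\log\mathbb{E}[e^{v^tX}]$, i.e. $\kappa_a[X]=D_v^a(\log\mathbb{E}[e^{v^tX}])|_{v=0}$. *)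

(* Defs.v *)
From HB Require Import structures.
From mathcomp Require Import all_boot all_order all_algebra.
From mathcomp Require Import all_classical all_reals all_analysis.
From mathcomp Require Import complex.
From mathcomp.analysis.showcase Require Import summability.

Set Implicit Arguments.
Unset Strict Implicit.
Unset Printing Implicit Defensive.

Import Order.TTheory GRing.Theory Num.Theory.
Import numFieldNormedType.Exports.

Local Open Scope classical_set_scope.
Local Open Scope complex_scope.
Local Open Scope ring_scope.

Section MultiIndices.
Variable g : nat.

Definition mindex := {ffun 'I_g -> nat}.

Implicit Types a b : mindex.

Definition mindex0 : mindex := [ffun=> 0%N].
Definition mdeg a : nat := (\sum_(i < g) a i)%N.
Definition mfact a : nat := (\prod_(i < g) (a i)`!)%N.
Definition mle b a : Prop := forall i, (b i <= a i)%N.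
Definition msub a b : mindex := [ffun i => (a i - b i)%N].
Definition mbinom (K : fieldType) a b : K :=
  (mfact a)%:R / ((mfact b)%:R * (mfact (msub a b))%:R).
Definition mpow (K : fieldType) (v : 'cV[K]_g) a : K :=
  \prod_(i < g) v i 0 ^+ a i.

(* The sequence of indices 0, ..., 0, 1, ..., 1, ... in which i occurs a i
   times: D^a differentiates once along each of its items, the last item
   being the innermost derivative. *)
Definition mseq a : seq 'I_g := flatten [seq nseq (a i) i | i <- enum 'I_g].

End MultiIndices.

Section Sums.
Variables (I : choiceType) (K : numFieldType).

(* Unconditional convergence: limit of the partial sums over the finite
   subsets of I, directed by inclusion. *)
Definition has_sum (f : I -> K) (s : K) : Prop := partial_sum f @ totally --> s.
Definition is_summable (f : I -> K) : Prop := exists s, has_sum f s.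
Definition csum (f : I -> K) : K := lim (partial_sum f @ totally).

End Sums.

Section Derivatives.
Variables (K : numFieldType) (g : nat).
Implicit Types (f : 'cV[K]_g -> K) (a : mindex g).

(* For K = R[i] the increment ranges over R[i]: this is the complex partial
   derivative. *)
Definition pderiv (j : 'I_g) f : 'cV[K]_g -> K :=
  fun u => 'D_(delta_mx j 0) (f : 'cV[K]_g -> K^o) u.

Definition grad f (u : 'cV[K]_g) : 'cV[K]_g := \col_(j < g) pderiv j f u.

Definition Dmulti a f : 'cV[K]_g -> K := foldr pderiv f (mseq a).

(* Formal derivatives of log f: the innermost derivative of log f along j is
   read as (pderiv j f) / f, which involves no choice of a branch of log. The
   empty sequence, for which there is no such reading, gets a dummy value. *)
Fixpoint Dlog_seq (s : seq 'I_g) f : 'cV[K]_g -> K :=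
  match s with
  | [::] => fun=> 0
  | [:: j] => fun u => pderiv j f u / f u
  | j :: s' => pderiv j (Dlog_seq s' f)
  end.

Definition Dlog a f : 'cV[K]_g -> K := Dlog_seq (mseq a) f.

End Derivatives.

Section ComplexExponential.
Variable R : realType.

Definition expC (z : R[i]) : R[i] :=
  (expR (complex.Re z) * cos (complex.Im z)) +i*
  (expR (complex.Re z) * sin (complex.Im z)).

(* e(x) = exp (2 pi x), without a factor i. *)
Definition ee (z : R[i]) : R[i] := expC ((2 * pi)%:C * z).

End ComplexExponential.

Section DiscreteGaussian.
Variables (R : realType) (g : nat).
Local Notation C := R[i].

Definition toC (n : 'cV[int]_g) : 'cV[C]_g := map_mx intr n.

Definition dotC (v w : 'cV[C]_g) : C := (v^T *m w) 0 0.

Definition siegel : set 'M[C]_g :=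
  [set B | B^T = B /\
     forall x : 'cV[R]_g, x != 0 ->
       0 < (x^T *m map_mx (@complex.Re R) B *m x) 0 0].

Definition gauss_term (u : 'cV[C]_g) (B : 'M[C]_g) (n : 'cV[int]_g) : C :=
  ee (- (2^-1) * ((toC n)^T *m B *m toC n) 0 0 + dotC (toC n) u).

Definition theta (u : 'cV[C]_g) (B : 'M[C]_g) : C := csum (gauss_term u B).

Definition Theta : set ('cV[C]_g * 'M[C]_g) :=
  [set uB | siegel uB.2 /\ theta uB.1 uB.2 = 0].

Definition dgauss (u : 'cV[C]_g) (B : 'M[C]_g) (n : 'cV[int]_g) : C :=
  (theta u B)^-1 * gauss_term u B n.

(* A random variable X with values in Z^g enters only through its complex
   distribution p, so E[f(X)], the moments, etc. are functions of p. *)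
Implicit Types (p : 'cV[int]_g -> C) (f : 'cV[int]_g -> C) (a : mindex g).

Definition Eterm p f : 'cV[int]_g -> C := fun n => f n * p n.
Definition Exp p f : C := csum (Eterm p f).

Definition mean p : 'cV[C]_g := \col_(i < g) Exp p (fun n => toC n i 0).

Definition monomial a : 'cV[int]_g -> C := fun n => mpow (toC n) a.
Definition cmonomial p a : 'cV[int]_g -> C := fun n => mpow (toC n - mean p) a.

Definition moment p a : C := Exp p (monomial a).
Definition cmoment p a : C := Exp p (cmonomial p a).

Definition expmgf (v : 'cV[C]_g) : 'cV[int]_g -> C :=
  fun n => expC (dotC v (toC n)).
Definition expchar (v : 'cV[C]_g) : 'cV[int]_g -> C :=
  fun n => expC ('i%C * dotC v (toC n)).

Definition mgf p (v : 'cV[C]_g) : C := Exp p (expmgf v).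
Definition charfun p (v : 'cV[C]_g) : C := Exp p (expchar v).

(* Formal power series are represented by their families of coefficients. *)
Definition charfun_fps p : mindex g -> C :=
  fun a => 'i%C ^+ mdeg a / (mfact a)%:R * moment p a.

Definition taylor_fps (F : 'cV[C]_g -> C) : mindex g -> C :=
  fun a => Dmulti a F 0 / (mfact a)%:R.

(* Meaningful for a <> 0 only, as is Dlog. *)
Definition cumulant p a : C := Dlog a (mgf p) 0.

End DiscreteGaussian.

Arguments siegel {R g}.
Arguments Theta {R g}.
Arguments monomial R {g} a n.

(* Main.v *)
(* Absorbing v into the linear term of the exponent turns E[exp(v^t X)] into
   theta(u + v/(2 pi)) / theta(u). Since Re B is positive definite, the Gaussian
   weights decay faster than any exp(-r |n|), so for every P of exponential
   growth the series sum_n P(n) e(-n^t B n / 2 + n^t w) converges absolutely and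
   can be differentiated termwise in w, each derivative along j inserting a
   factor 2 pi n_j. This gives the moments, and then the central moments by
   expanding (X - mu)^a. The Taylor expansion of the characteristic function
   comes from dominated convergence, the partial sums of the exponential series
   of i v^t n being dominated by exp(sum_j |v_j n_j|). The cumulants only need
   the behaviour of logarithmic derivatives under v |-> u + c v. *)
Require Import Defs.
From HB Require Import structures.
From mathcomp Require Import all_boot all_order all_algebra finmap.
From mathcomp Require Import all_classical all_reals all_analysis.
From mathcomp Require Import complex zify ring lra.
From mathcomp.analysis.showcase Require Import summability.

Set Implicit Arguments.
Unset Strict Implicit.
Unset Printing Implicit Defensive.

Import Order.TTheory GRing.Theory Num.Theory.
Import numFieldNormedType.Exports.
Import Normc.

Local Open Scope classical_set_scope.
Local Open Scope complex_scope.
Local Open Scope ring_scope.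

#[local] Existing Instance totally_filter.

(** * Unordered sums *)

Lemma normr_normc (R : realType) (z : R[i]) : `|z| = (normc z)%:C.
Proof. by []. Qed.

Lemma normc_ge0 (R : realType) (z : R[i]) : 0 <= normc z.
Proof. by rewrite -ler0c -normr_normc. Qed.

Lemma normcXn (R : realType) (z : R[i]) n : normc (z ^+ n) = normc z ^+ n.
Proof. by elim: n => [|n IH]; rewrite ?expr0 ?normc1// !exprS normcM IH. Qed.

Lemma normc_real (R : realType) (x : R) : normc x%:C = `|x|.
Proof. by rewrite /= expr0n /= addr0 sqrtr_sqr. Qed.

Lemma normc_nat (R : realType) n : normc (n%:R : R[i]) = n%:R.
Proof. by rewrite -(rmorph_nat (real_complex R)) normc_real ger0_norm. Qed.

Lemma normc_sum (R : realType) (I : Type) (r : seq I) (P : pred I)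
    (F : I -> R[i]) :
  normc (\sum_(i <- r | P i) F i) <= \sum_(i <- r | P i) normc (F i).
Proof.
by rewrite -lecR -normr_normc (rmorph_sum (real_complex R)); exact: ler_norm_sum.
Qed.

Lemma normc_prod (R : realType) (I : Type) (r : seq I) (P : pred I)
    (F : I -> R[i]) :
  normc (\prod_(i <- r | P i) F i) = \prod_(i <- r | P i) normc (F i).
Proof. by apply: (big_morph _ (@normcM R) (normc1 R)). Qed.

(** In [R[i]] only numbers with equal imaginary parts are comparable, so a positive epsilon is real:
    complex limits can be tested with epsilons in [R]. *)
Lemma cvg_normcP (R : realType) (T : Type) (F : set_system T) (FF : Filter F)
    (f : T -> (R[i] : numFieldType)) (l : (R[i] : numFieldType)) :
  f @ F --> l <->
  forall e : R, 0 < e -> \forall x \near F, normc (l - f x) < e.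
Proof.
split=> [/cvgrPdist_lt fl e e0|fl].
  have := fl e%:C; rewrite ltcR => /(_ e0).
  by apply: filterS => x; rewrite normr_normc ltcR.
apply/cvgrPdist_lt => -[e e']; rewrite ltcE /= => /andP[/eqP -> e0].
by apply: filterS (fl e e0) => x; rewrite normr_normc ltcR.
Qed.

Lemma cvg_complex (R : realType) (T : Type) (F : set_system T) (FF : Filter F)
    (a b : T -> R) (s t : R) :
  a @ F --> s -> b @ F --> t ->
  (fun x => (a x +i* b x : (R[i] : numFieldType))) @ F
    --> (s +i* t : (R[i] : numFieldType)).
Proof.
move=> /cvgrPdist_lt hs /cvgrPdist_lt ht; apply/cvg_normcP => e e0.
have e20 : 0 < e / 2 by rewrite divr_gt0.
apply: filterS2 (hs _ e20) (ht _ e20) => x hs' ht'.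
have -> : s +i* t - (a x +i* b x) = (s - a x)%:C + 'i * (t - b x)%:C.
  by rewrite [LHS]complexE.
rewrite [e]splitr; apply: le_lt_trans (le_normcD _ _) _.
rewrite normcM !normc_real /= expr0n expr1n add0r sqrtr1 mul1r.
exact: ltrD.
Qed.

Lemma num_cvg_unique (K : numFieldType) (T : Type) (F : set_system T)
    (FF : ProperFilter F) (f : T -> K) (s t : K) :
  f @ F --> s -> f @ F --> t -> s = t.
Proof.
by move=> fs ft; rewrite -(cvg_lim (@norm_hausdorff _ _) fs); apply: cvg_lim ft.
Qed.

Lemma partial_sumE (I : choiceType) (K : zmodType) (f : I -> K) (A : {fset I}) :
  partial_sum f A = \sum_(i <- A) f i.
Proof. by rewrite /partial_sum (big_seq_fsetE _ _ predT). Qed.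

Section SumsTheory.
Variables (I : choiceType).

Lemma totally_ge (A : {fset I}) : \forall B \near totally, (A `<=` B)%fset.
Proof. by exists A. Qed.

Lemma has_sum_csum (K : numFieldType) (f : I -> K) (s : K) :
  has_sum f s -> csum f = s.
Proof. by move=> fs; apply: cvg_lim fs; exact: norm_hausdorff. Qed.

Lemma eq_has_sum (K : numFieldType) (f h : I -> K) (s : K) :
  f =1 h -> has_sum f s -> has_sum h s.
Proof. by move=> /funext ->. Qed.

Lemma eq_csum (K : numFieldType) (f h : I -> K) :
  f =1 h -> csum f = csum h.
Proof. by move=> /funext ->. Qed.

Lemma has_sumD (K : numFieldType) (f h : I -> K) (s t : K) :
  has_sum f s -> has_sum h t -> has_sum (fun i => f i + h i) (s + t).
Proof.
move=> fs ht; rewrite /has_sum.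
have -> : partial_sum (fun i => f i + h i) = partial_sum f \+ partial_sum h.
  by apply/funext => A; rewrite /= /partial_sum big_split.
exact: cvgD.
Qed.

Lemma has_sumZ (K : numFieldType) (c : K) (f : I -> K) (s : K) :
  has_sum f s -> has_sum (fun i => c * f i) (c * s).
Proof.
move=> fs; rewrite /has_sum.
have -> : partial_sum (fun i => c * f i) = (fun A => c * partial_sum f A).
  by apply/funext => A; rewrite /= /partial_sum mulr_sumr.
by apply: cvgM => //; exact: cvg_cst.
Qed.

Lemma has_sumB (K : numFieldType) (f h : I -> K) (s t : K) :
  has_sum f s -> has_sum h t -> has_sum (fun i => f i - h i) (s - t).
Proof.
move=> fs /(@has_sumZ _ (-1)) ht; rewrite -[- t]mulN1r.
by apply: eq_has_sum (has_sumD fs ht) => i; rewrite mulN1r.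
Qed.

Lemma has_sum0 (K : numFieldType) : has_sum (fun _ : I => 0 : K) 0.
Proof.
rewrite /has_sum (_ : partial_sum _ = fun=> 0); first exact: cvg_cst.
by apply/funext => A; rewrite /partial_sum big1.
Qed.

Lemma has_sum_sum (K : numFieldType) (J : Type) (r : seq J) (f : J -> I -> K)
    (s : J -> K) :
  (forall j, has_sum (f j) (s j)) ->
  has_sum (fun i => \sum_(j <- r) f j i) (\sum_(j <- r) s j).
Proof.
move=> fs; elim: r => [|j r IH].
  by rewrite big_nil; apply: eq_has_sum (@has_sum0 K) => i; rewrite big_nil.
rewrite big_cons; apply: eq_has_sum (has_sumD (fs j) IH) => i.
by rewrite big_cons.
Qed.

(** Such a sequence eventually contains any given finite set of indices, so it follows the filter
    [totally]. This evaluates unordered sums by ordinary limits. *)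
Lemma has_sum_seq (K : numFieldType) (f : I -> K) (s : K)
    (A : nat -> {fset I}) :
  (forall i, \forall N \near \oo, i \in A N) ->
  has_sum f s -> (fun N => \sum_(i <- A N) f i) @ \oo --> s.
Proof.
move=> Ai fs.
have -> : (fun N => \sum_(i <- A N) f i) = partial_sum f \o A.
  by apply/funext => N /=; rewrite partial_sumE.
apply: cvg_comp fs => X [B _ BX].
have : \forall N \near \oo, forall i : B, val i \in A N.
  by apply: filter_forall => i; apply: filterS (Ai (val i)).
apply: filterS => N /= H; apply: BX; apply/fsubsetP => i iB.
exact: (H [` iB]%fset).
Qed.

(** Choose [A0] with sum within [e] of the supremum of all finite sums: a disjoint set can then add
    less than [e]. *)
Lemma bounded_sum_tail (R : realType) (G : I -> R) (M : R) :
  (forall i, 0 <= G i) -> (forall A : {fset I}, \sum_(i <- A) G i <= M) ->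
  forall e, 0 < e -> exists A0 : {fset I}, forall A : {fset I},
    [disjoint A0 & A]%fset -> \sum_(i <- A) G i < e.
Proof.
move=> G0 GM e e0.
pose S := [set \sum_(i <- A) G i | A in [set: {fset I}]].
have supS : has_sup S.
  split; first by exists (\sum_(i <- fset0) G i); exists fset0.
  by exists M => _ [A _ <-].
have [_ [A0 _ <-] A0S] := sup_adherent e0 supS.
exists A0 => A dA.
have : \sum_(i <- (A0 `|` A)%fset) G i <= sup S.
  by apply: sup_upper_bound => //; exists (A0 `|` A)%fset.
have -> : \sum_(i <- (A0 `|` A)%fset) G i
    = \sum_(i <- A0) G i + \sum_(i <- A) G i.
  rewrite -big_cat; apply: perm_big; apply: uniq_perm.
  - exact: fset_uniq.
  - rewrite cat_uniq !fset_uniq andbT /=; apply/hasPn => i iA.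
    by apply/negP => iA0; move/fdisjointP/(_ _ iA0): dA; rewrite iA.
  - by move=> i; rewrite in_fsetU mem_cat.
lra.
Qed.

Lemma fsum_le_subset (R : realType) (G : I -> R) (A B : {fset I}) :
  (forall i, 0 <= G i) -> (A `<=` B)%fset ->
  \sum_(i <- A) G i <= \sum_(i <- B) G i.
Proof.
move=> G0 AB; rewrite (big_fsetID _ (mem A) B) /=.
have -> : [fset x in B | x \in A]%fset = A.
  apply/fsetP => i; rewrite !inE /=; apply/andP/idP => [[]//|iA].
  by split=> //; apply: (fsubsetP AB).
by rewrite lerDl sumr_ge0.
Qed.

(** Finite sums grow with the index set, so they converge to their supremum. *)
Lemma nonneg_has_sum (R : realType) (G : I -> R) (M : R) :
  (forall i, 0 <= G i) -> (forall A : {fset I}, \sum_(i <- A) G i <= M) ->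
  exists s, has_sum G s.
Proof.
move=> G0 GM.
pose S := [set \sum_(i <- A) G i | A in [set: {fset I}]].
have supS : has_sup S.
  split; first by exists (\sum_(i <- fset0) G i); exists fset0.
  by exists M => _ [A _ <-].
exists (sup S); apply/cvgrPdist_lt => e e0.
have [_ [A0 _ <-] A0S] := sup_adherent e0 supS.
apply: filterS (totally_ge A0) => B A0B; rewrite partial_sumE.
have BS : \sum_(i <- B) G i <= sup S.
  by apply: sup_upper_bound => //; exists B.
have := fsum_le_subset G0 A0B.
by rewrite ger0_norm ?subr_ge0 //; lra.
Qed.

(** Write [f] as [(|f| + f) - |f|], a difference of two nonnegative families with bounded finite
    sums. *)
Lemma real_has_sum (R : realType) (f : I -> R) (M : R) :
  (forall A : {fset I}, \sum_(i <- A) `|f i| <= M) -> exists s, has_sum f s.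
Proof.
move=> fM.
have [i|A|s hs] := @nonneg_has_sum R (fun i => `|f i| + f i) (2 * M).
- by have := ler_norm (- f i); rewrite normrN; lra.
- apply: le_trans (ler_wpM2l (ler0n R 2) (fM A)); rewrite mulr_sumr.
  by apply: ler_sum => i _; rewrite mulr_natl mulr2n lerD2l ler_norm.
have [//|//|t ht] := @nonneg_has_sum R (fun i => `|f i|) M.
exists (s - t); apply: eq_has_sum (has_sumB hs ht) => i.
by rewrite addrAC subrr add0r.
Qed.

Lemma normc_has_sum (R : realType) (f : I -> R[i]) (M : R) :
  (forall A : {fset I}, \sum_(i <- A) normc (f i) <= M) -> is_summable f.
Proof.
move=> fM.
have lenorm (x y : R) : `|x| <= normc (x +i* y) /\ `|y| <= normc (x +i* y).
  by split; rewrite -sqrtr_sqr /= ler_wsqrtr // ?lerDl ?lerDr sqr_ge0.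
have [A|s hs] := @real_has_sum R (fun i => complex.Re (f i)) M.
  apply: le_trans (fM A); apply: ler_sum => i _.
  by case: (f i) => x y; have [] := lenorm x y.
have [A|t ht] := @real_has_sum R (fun i => complex.Im (f i)) M.
  apply: le_trans (fM A); apply: ler_sum => i _.
  by case: (f i) => x y; have [] := lenorm x y.
exists (s +i* t); rewrite /has_sum.
rewrite (_ : partial_sum f = fun A => partial_sum (fun i => complex.Re (f i)) A
    +i* partial_sum (fun i => complex.Im (f i)) A); first exact: cvg_complex.
apply/funext => A; rewrite [LHS]complexE [RHS]complexE /= /partial_sum.
by rewrite !raddf_sum.
Qed.

Lemma normc_has_sum_le (R : realType) (f : I -> R[i]) (s : R[i]) (M : R) :
  (forall A : {fset I}, \sum_(i <- A) normc (f i) <= M) ->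
  has_sum f s -> normc s <= M.
Proof.
move=> fM /cvg_normcP fs; rewrite leNgt; apply/negP => Ms.
have /filter_ex[A] := fs (normc s - M) ltac:(by rewrite subr_gt0).
rewrite partial_sumE => hA.
have := le_normcD (s - \sum_(i <- A) f i) (\sum_(i <- A) f i).
rewrite subrK; have := fM A; have := normc_sum A predT f.
lra.
Qed.

(** Dominated convergence for sums: outside a finite set [A0] the terms are controlled by the tail
    of the majorant [G], and on [A0] finitely many terms are eventually small. *)
Lemma has_sum_dominated_cvg0 (R : realType) (T : Type) (F : set_system T)
    (FF : Filter F) (d : T -> I -> R[i]) (t : T -> R[i]) (G : I -> R) (M : R) :
  (forall A : {fset I}, \sum_(i <- A) G i <= M) ->
  (forall x i, normc (d x i) <= G i) ->
  (forall i e, 0 < e -> \forall x \near F, normc (d x i) < e) ->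
  (forall x, has_sum (d x) (t x)) ->
  forall e, 0 < e -> \forall x \near F, normc (t x) < e.
Proof.
move=> GM dG d0 dt e e0.
(* A point of [T] makes the majorant [G] nonnegative; without one the claim is vacuous. *)
have [[x0]|T0] := pselect (inhabited T); last first.
  by apply: filterE => x; case: T0; exists.
have G0 i : 0 <= G i by apply: le_trans (dG x0 i); exact: normc_ge0.
have e20 : 0 < e / 4 by rewrite divr_gt0.
have [A0 A0P] := bounded_sum_tail G0 GM e20.
(* A quarter of [e] is shared among the elements of [A0]; the successor keeps the divisor nonzero
   for empty [A0]. Two quarters leave room for the strict inequality, since passing to the sum gives
   only a weak one. *)
have c0 : 0 < e / 4 / (#|` A0|.+1)%:R by rewrite divr_gt0.
have : \forall x \near F, forall i : A0,
    normc (d x (val i)) < e / 4 / (#|` A0|.+1)%:R.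
  by apply: filter_forall => i; apply: d0.
move=> dx0. apply: filterS dx0 => x dx.
apply: (@le_lt_trans _ _ (e / 4 + e / 4)); last lra.
apply: (normc_has_sum_le _ (dt x)) => A.
rewrite (big_fsetID _ (mem A0) A) /=; apply: lerD; last first.
  apply: ltW; apply: le_lt_trans (A0P [fset x in A | x \notin A0]%fset _).
    by apply: ler_sum.
  by apply/fdisjointP => i iA0; rewrite !inE /= iA0 andbF.
apply: (@le_trans _ _ (\sum_(i <- A0) normc (d x i))).
  apply: fsum_le_subset => [i|]; first exact: normc_ge0.
  by apply/fsubsetP => i; rewrite !inE => /andP[].
apply: (@le_trans _ _ (\sum_(i <- A0) e / 4 / (#|` A0|.+1)%:R)).
  rewrite big_seq [leRHS]big_seq; apply: ler_sum => i iA0.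
  exact: ltW (dx [` iA0]%fset).
rewrite big_const_seq count_predT iter_addr_0 -[leLHS]mulr_natr.
rewrite -[leLHS]mulrA ler_piMr //.
  exact: ltW.
by rewrite mulrC ler_pdivrMr // mul1r ler_nat.
Qed.
End SumsTheory.

(** * Products of sums and the exponential series *)

Section Box.
Variables (g : nat) (K : choiceType).

(** The box [T^g], taken as an image of the functions into the subtype [T] so that the distributive
    law for finite types applies. *)
Definition fset_box (T : {fset K}) : {fset {ffun 'I_g -> K}} :=
  [fset [ffun j => val (h j)] | h : {ffun 'I_g -> T} in predT]%fset.

Lemma mem_fset_box (T : {fset K}) (a : {ffun 'I_g -> K}) :
  reflect (forall j, a j \in T) (a \in fset_box T).
Proof.
apply: (iffP (imfsetP _ _ _ _)) => [[h _ ->] j|aT].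
  by rewrite ffunE; exact: valP.
exists [ffun j => [` aT j]%fset] => //.
by apply/ffunP => j; rewrite !ffunE.
Qed.

Lemma sum_fset_box (S : comNzRingType) (f : 'I_g -> K -> S) (T : {fset K}) :
  \sum_(a <- fset_box T) \prod_j f j (a j) = \prod_j \sum_(k <- T) f j k.
Proof.
rewrite big_imfset /=; last first.
  move=> h1 h2 _ _ /ffunP eqh; apply/ffunP => j; apply: val_inj.
  by have := eqh j; rewrite !ffunE.
under [RHS]eq_bigr do rewrite (big_seq_fsetE _ _ predT).
rewrite bigA_distr_bigA big_enum /=; apply: eq_bigr => h _.
by apply: eq_bigr => j _; rewrite ffunE.
Qed.

(** A finite [A] lies in the box over the set [T] of all its coordinates, and over a box the sum of
    products factors. *)
Lemma sum_prod_le (R : realType) (f : 'I_g -> K -> R) (M : 'I_g -> R) :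
  (forall j k, 0 <= f j k) ->
  (forall j (T : {fset K}), \sum_(k <- T) f j k <= M j) ->
  forall A : {fset {ffun 'I_g -> K}},
    \sum_(a <- A) \prod_j f j (a j) <= \prod_j M j.
Proof.
move=> f0 fM A.
pose T :=
  [fset k in [seq a j | a : {ffun 'I_g -> K} <- A, j <- enum 'I_g]]%fset.
apply: (@le_trans _ _ (\sum_(a <- fset_box T) \prod_j f j (a j))).
  apply: fsum_le_subset => [a|]; first by apply: prodr_ge0.
  apply/fsubsetP => a aA; apply/mem_fset_box => j; rewrite !inE /=.
  by apply/allpairsP; exists (a, j); rewrite mem_enum.
rewrite sum_fset_box; apply: ler_prod => j _.
by rewrite sumr_ge0 /=.
Qed.

End Box.

Lemma big_fset_iota (S : nmodType) (F : nat -> S) (N : nat) :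
  \sum_(k <- [fset k in iota 0 N]%fset) F k = \sum_(0 <= k < N) F k.
Proof.
apply: perm_big; apply: uniq_perm; rewrite ?fset_uniq ?iota_uniq //.
by move=> k; rewrite !inE /index_iota subn0.
Qed.

Lemma in_fset_iota (N k : nat) : (k \in [fset k in iota 0 N]%fset) = (k < N)%N.
Proof. by rewrite !inE /= mem_iota. Qed.

Section ProductOfSums.
Variables (R : realType) (g : nat).

Lemma cvg_prod_seq (J : Type) (r : seq J) (K : numFieldType)
    (u : J -> nat -> K) (s : J -> K) :
  (forall j, u j @ \oo --> s j) ->
  (fun N => \prod_(j <- r) u j N) @ \oo --> \prod_(j <- r) s j.
Proof.
move=> us; elim: r => [|j r IH].
  rewrite big_nil (_ : (fun _ => _) = fun=> 1); first exact: cvg_cst.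
  by apply/funext => N; rewrite big_nil.
rewrite big_cons (_ : (fun _ => _) = fun N => u j N * \prod_(j <- r) u j N).
  by apply: cvgM.
by apply/funext => N; rewrite big_cons.
Qed.

(** The absolute bounds give some sum [t]. Along the boxes with sides [0, ..., N-1] its partial sums
    are products of partial sums, which identifies [t]. *)
Lemma has_sum_prod (f : 'I_g -> nat -> R[i]) (s : 'I_g -> R[i])
    (M : 'I_g -> R) :
  (forall j (A : {fset nat}), \sum_(k <- A) normc (f j k) <= M j) ->
  (forall j, has_sum (f j) (s j)) ->
  has_sum (fun a : {ffun 'I_g -> nat} => \prod_j f j (a j)) (\prod_j s j).
Proof.
move=> fM fs.
have [|t ht] := @normc_has_sum _ R (fun a : {ffun 'I_g -> nat} =>
    \prod_j f j (a j)) (\prod_j M j).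
  move=> A; rewrite (eq_bigr (fun a : {ffun 'I_g -> nat} =>
    \prod_j normc (f j (a j)))); last by move=> a _; exact: normc_prod.
  by apply: (sum_prod_le (f := fun j k => normc (f j k))) => // j k;
    exact: normc_ge0.
rewrite (_ : \prod_j s j = t) //.
pose B N := fset_box g [fset k in iota 0 N]%fset.
have Bt : (fun N => \sum_(a <- B N) \prod_j f j (a j)) @ \oo --> t.
  apply: has_sum_seq ht => a.
  exists (\max_j a j).+1 => //= N aN; apply/mem_fset_box => j.
  rewrite in_fset_iota; apply: leq_trans aN; rewrite ltnS.
  exact: leq_bigmax.
have Bs : (fun N => \sum_(a <- B N) \prod_j f j (a j)) @ \oo
    --> (\prod_j s j : (R[i] : numFieldType)).
  under eq_fun do rewrite sum_fset_box; apply: cvg_prod_seq => j.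
  apply: has_sum_seq (fs j) => k.
  by exists k.+1 => //= N kN; rewrite !inE /= mem_iota.
exact: num_cvg_unique Bs Bt.
Qed.

End ProductOfSums.

(** * The complex exponential as a power series *)

Section ExpSeries.
Variable R : realType.
Local Notation C := R[i].

Definition exp_term (z : C) (k : nat) : C := z ^+ k / k`!%:R.

Lemma normc_exp_term z k : normc (exp_term z k) = normc z ^+ k / k`!%:R.
Proof. by rewrite /exp_term normcM normcV normcXn normc_nat. Qed.

Lemma sum_exp_term_le z (A : {fset nat}) :
  \sum_(k <- A) normc (exp_term z k) <= expR (normc z).
Proof.
have e0 k : 0 <= normc (exp_term z k) by exact: normc_ge0.
pose N := (\max_(k : A) val k).+1.
apply: (@le_trans _ _
  (\sum_(k <- [fset k in iota 0 N]%fset) normc (exp_term z k))).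
  apply: fsum_le_subset => //; apply/fsubsetP => k kA.
  rewrite in_fset_iota ltnS.
  exact: (leq_bigmax [` kA]%fset).
rewrite big_fset_iota.
have -> : \sum_(0 <= k < N) normc (exp_term z k)
    = series (exp_coeff (normc z)) N.
  by apply: eq_bigr => k _; rewrite normc_exp_term.
apply: nondecreasing_cvgn_le; last exact: is_cvg_series_exp_coeff.
apply: nondecreasing_series => k _ _; apply: exp_coeff_ge0; exact: normc_ge0.
Qed.

(** Absolute convergence already provides a sum; the exhausting sequence [B] only has to identify
    its value. *)
Lemma has_sum_exp_term_seq z (s : (C : numFieldType)) (B : nat -> {fset nat}) :
  (forall k, \forall N \near \oo, k \in B N) ->
  (fun N => (\sum_(k <- B N) exp_term z k : (C : numFieldType))) @ \oo --> s ->
  has_sum (exp_term z) s.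
Proof.
move=> Bk Bs; have [t ht] := normc_has_sum (sum_exp_term_le z).
rewrite (_ : s = t) //.
exact: num_cvg_unique Bs (has_sum_seq Bk ht).
Qed.

Lemma mem_fset_iota k : \forall N \near \oo, k \in [fset k in iota 0 N]%fset.
Proof. by exists k.+1 => //= N kN; rewrite in_fset_iota. Qed.

Lemma has_sum_exp_real (x : R) : has_sum (exp_term x%:C) (expR x)%:C.
Proof.
apply: has_sum_exp_term_seq mem_fset_iota _.
under eq_fun do rewrite big_fset_iota.
have -> : (fun N => \sum_(0 <= k < N) exp_term x%:C k)
    = (fun N => series (exp_coeff x) N +i* 0).
  apply/funext => N; rewrite -[RHS]/((series (exp_coeff x) N)%:C) /series /=.
  rewrite raddf_sum; apply: eq_bigr => k _.
  by rewrite /exp_term /= rmorphM rmorphXn fmorphV rmorph_nat.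
apply: cvg_complex; last exact: cvg_cst.
exact: is_cvg_series_exp_coeff.
Qed.

(** The parity of [k] decides whether [i^k] is real or imaginary, which separates the cosine from
    the sine coefficients. *)
Lemma exp_term_imag (y : R) k :
  exp_term ('i * y%:C) k = cos_coeff y k +i* sin_coeff y k.
Proof.
have ik : 'i ^+ k = ((~~ odd k)%:R * (-1) ^+ k./2)
    +i* ((odd k)%:R * (-1) ^+ k.-1./2) :> C.
  have -> : 'i ^+ k = 'i ^+ odd k * ((-1) ^+ k./2)%:C :> C.
    rewrite -[k in LHS]odd_double_half exprD -mul2n exprM sqr_i.
    by rewrite rmorphXn rmorphN1.
  (* The sine coefficient carries the exponent [k.-1./2], which agrees with [k./2] for odd [k]. *)
  have kE : odd k -> (k.-1./2 = k./2)%N.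
    by case: k => //= k /negPf; rewrite uphalf_half => ->.
  by case: (odd k) kE => [->//|_]; simpc.
rewrite /exp_term exprMn ik.
have -> : (y%:C) ^+ k = (y ^+ k)%:C by rewrite rmorphXn.
have -> : (k`!%:R : C) = (k`!%:R)%:C by rewrite rmorph_nat.
rewrite -mulrA -fmorphV -rmorphM /cos_coeff /sin_coeff /=; simpc.
by rewrite !mulrA.
Qed.

Lemma has_sum_exp_imag (y : R) :
  has_sum (exp_term ('i * y%:C)) (cos y +i* sin y).
Proof.
apply: has_sum_exp_term_seq mem_fset_iota _.
under eq_fun do rewrite big_fset_iota.
have -> : (fun N => \sum_(0 <= k < N) exp_term ('i * y%:C) k)
    = (fun N => series (cos_coeff y) N +i* series (sin_coeff y) N).
  apply/funext => N; rewrite [RHS]complexE /= /series /= !raddf_sum /=.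
  rewrite mulr_sumr -big_split /=; apply: eq_bigr => k _.
  by rewrite exp_term_imag [LHS]complexE.
apply: cvg_complex.
- rewrite unlock; exact: is_cvg_series_cos_coeff.
- rewrite unlock; exact: is_cvg_series_sin_coeff.
Qed.

(** As [expC] is defined through the real exponential, cosine and sine, its series is obtained by
    multiplying the series at [Re z] and at [i Im z]. *)
Lemma has_sum_exp (z : C) : has_sum (exp_term z) (expC z).
Proof.
pose w (j : 'I_2) :=
  if j == 0 then (complex.Re z)%:C else 'i * (complex.Im z)%:C.
pose s (j : 'I_2) := if j == 0 then (expR (complex.Re z))%:C
  else cos (complex.Im z) +i* sin (complex.Im z).
have ws : has_sum (fun a : {ffun 'I_2 -> nat} => \prod_j exp_term (w j) (a j))
    (\prod_j s j).
  apply: (@has_sum_prod R 2 (fun j => exp_term (w j)) s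
    (fun j => expR (normc (w j)))) => j.
    exact: sum_exp_term_le.
  rewrite /w /s; case: ifP => _; first exact: has_sum_exp_real.
  exact: has_sum_exp_imag.
have -> : expC z = \prod_j s j.
  rewrite big_ord_recl big_ord_recl big_ord0 mulr1 /s /= /expC.
  by simpc.
apply: has_sum_exp_term_seq mem_fset_iota _.
under eq_fun do rewrite big_fset_iota.
(* Cauchy product: the triangles {(i, k - i) | i <= k < N} exhaust N x N, and
   the sum over the k-th antidiagonal is z^k / k! by the binomial formula. *)
pose e (p : nat * nat) :=
  [ffun j : 'I_2 => if j == 0 then p.2 else (p.1 - p.2)%N].
pose S N := [seq (k, i) | k <- iota 0 N, i <- iota 0 k.+1].
have memS N k i : ((k, i) \in S N) = (k < N)%N && (i <= k)%N.
  apply/allpairsPdep/andP => [[k1 [i1 [+ + [-> ->]]]]|[kN ik]].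
    by rewrite !mem_iota.
  by exists k, i; rewrite !mem_iota /= add0n.
pose T N : {fset {ffun 'I_2 -> nat}} := [fset e p | p in S N]%fset.
have -> : (fun N => \sum_(0 <= k < N) exp_term z k)
  = (fun N => \sum_(a <- T N) \prod_j exp_term (w j) (a j)).
  apply/funext => N; rewrite big_imfset /=; last first.
    move=> [k i] [k' i'] ki ki'.
    have : (k, i) \in S N by exact: ki.
    have : (k', i') \in S N by exact: ki'.
    rewrite !memS => /andP[_ ik'] /andP[_ ik] /ffunP ee.
    have := ee 0; have := ee 1; rewrite !ffunE /= => e1 e2.
    by congr pair => //; rewrite -(subnK ik) -(subnK ik') e1 e2.
  have uS : uniq (S N).
    apply: allpairs_uniq_dep => [|k _|[k i] [k' i'] _ _ []];
      rewrite ?iota_uniq //; by move=> -> ->.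
  rewrite undup_id //.
  rewrite big_allpairs_dep /index_iota subn0; apply: eq_bigr => k _.
  have -> : iota 0 k.+1 = index_iota 0 k.+1 by rewrite /index_iota subn0.
  rewrite big_mkord.
  have zE : z = w 0 + w 1 by rewrite /w /= -complexE.
  rewrite {1}/exp_term zE addrC exprDn mulr_suml; apply: eq_bigr => i _.
  rewrite big_ord_recl big_ord_recl big_ord0 mulr1 /exp_term !ffunE /=.
  have ik : (i <= k)%N by rewrite -ltnS.
  have : ('C(k, i)%:R : C) * (i`!%:R * (k - i)`!%:R) = k`!%:R.
    by rewrite -!natrM bin_fact.
  have n0 n : (n`!%:R : C) != 0 by rewrite pnatr_eq0 -lt0n fact_gt0.
  move=> <-; rewrite -mulr_natl.
  have C0 : ('C(k, i)%:R : C) != 0 by rewrite pnatr_eq0 -lt0n bin_gt0.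
  rewrite /lift /=.
  by field; rewrite !n0 C0.
apply: (@has_sum_seq _ (C : numFieldType) _ _ T _ ws) => a.
(* The pair [a] lies on the antidiagonal [a 0 + a 1], hence in every triangle with [N] beyond
   that. *)
exists (a 0%R + a 1%R).+1 => //= N aN; apply/imfsetP => /=.
exists (a 0%R + a 1%R, a 0%R)%N.
  by rewrite memS aN leq_addr.
apply/ffunP => j; rewrite ffunE /=.
case: ifP => [/eqP -> //|j0]; rewrite addKn; congr (a _).
by apply/val_inj; case: j j0 => [[|[]]].
Qed.
End ExpSeries.

Section ExpTheory.
Variable R : realType.
Local Notation C := R[i].

Lemma expC0 : expC (0 : C) = 1.
Proof. by rewrite /expC /= expR0 cos0 sin0 mulr0 mulr1. Qed.

Lemma expCD (z w : C) : expC (z + w) = expC z * expC w.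
Proof.
rewrite /expC !raddfD /= expRD cosD sinD; simpc; congr (_ +i* _); ring.
Qed.

Lemma expC_sum (I : Type) (r : seq I) (F : I -> C) :
  expC (\sum_(i <- r) F i) = \prod_(i <- r) expC (F i).
Proof. by rewrite (big_morph _ expCD expC0). Qed.

Lemma normc_expC (z : C) : normc (expC z) = expR (complex.Re z).
Proof.
rewrite /expC /= !exprMn -mulrDr cos2Dsin2 mulr1 sqrtr_sqr ger0_norm //.
Qed.

Lemma le_Re_normc (z : C) : complex.Re z <= normc z.
Proof.
by case: z => x y; apply: le_trans (ler_norm _) _; rewrite -sqrtr_sqr /=
  ler_wsqrtr // lerDl sqr_ge0.
Qed.

(** The remainder is the sum of the [z^(k+2) / (k+2)!]; [z^2] factors out and [(k+2)!] is at least
    [k!]. The series is truncated at the cost of an arbitrary [e]. *)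
Lemma expC_taylor2 (z : C) :
  normc (expC z - 1 - z) <= normc z ^+ 2 * expR (normc z).
Proof.
apply/ler_addgt0Pr => e e0.
have /cvg_normcP/(_ e e0)/filter_ex[N] : (fun N =>
    (\sum_(k <- [fset k in iota 0 N.+2]%fset) exp_term z k
      : (C : numFieldType)))
    @ \oo --> (expC z : (C : numFieldType)).
  apply: has_sum_seq (@has_sum_exp _ z) => k.
  by exists k => // N kN; rewrite in_fset_iota (leq_trans _ (leqnSn _)).
rewrite big_fset_iota !big_nat_recl //= => hN.
have -> : expC z - 1 - z = \sum_(0 <= k < N) exp_term z k.+2
    + (expC z
      - (exp_term z 0 + (exp_term z 1 + \sum_(0 <= k < N) exp_term z k.+2))).
  by rewrite /exp_term !divr1 expr0 expr1; ring.
apply: le_trans (le_normcD _ _) (lerD _ (ltW hN)).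
apply: le_trans (normc_sum _ _ _) _.
have := sum_exp_term_le z [fset k in iota 0 N]%fset; rewrite big_fset_iota.
move=> /(ler_wpM2l (sqr_ge0 (normc z))); apply: le_trans.
rewrite mulr_sumr; apply: ler_sum => k _.
rewrite !normc_exp_term !exprS expr0 mulr1 !mulrA; apply: ler_pM => //.
- by rewrite !mulr_ge0 ?exprn_ge0 ?normc_ge0.
- by rewrite lef_pV2 ?posrE ?ltr0n ?fact_gt0 // ler_nat !factS mulnA leq_pmull.
Qed.

Variable g : nat.
Implicit Type z : 'I_g -> C.

(** The bound is uniform in the truncation [A], as the domination of the truncated exponential
    series requires. *)
Lemma sum_exp_mindex_le z (A : {fset mindex g}) :
  \sum_(a <- A) normc (\prod_j exp_term (z j) (a j))
    <= expR (\sum_j normc (z j)).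
Proof.
rewrite expR_sum (eq_bigr (fun a : {ffun 'I_g -> nat} =>
  \prod_j normc (exp_term (z j) (a j)))) => [|a _]; last exact: normc_prod.
apply: (sum_prod_le (f := fun j k => normc (exp_term (z j) k))
  (M := fun j => expR (normc (z j)))) => [j k|j T]; first exact: normc_ge0.
exact: sum_exp_term_le.
Qed.

Lemma has_sum_exp_mindex z :
  has_sum (fun a : mindex g => \prod_j exp_term (z j) (a j))
    (expC (\sum_j z j)).
Proof.
rewrite expC_sum.
apply: (@has_sum_prod R g (fun j => exp_term (z j)) (fun j => expC (z j))
  (fun j => expR (normc (z j)))) => j; first exact: sum_exp_term_le.
exact: has_sum_exp.
Qed.

End ExpTheory.

(** * Gaussian bounds *)

(** On the compact unit sphere the quadratic form has a positive minimum, and homogeneity extends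
    the bound. The sphere is that of the maximum norm, hence the division by [g] when comparing with
    the sum of squares. *)
Lemma posdef_ge (R : realType) (g : nat) (A : 'M[R]_g) :
  (forall x : 'cV[R]_g, x != 0 -> 0 < (x^T *m A *m x) 0 0) ->
  exists2 c : R, 0 < c &
    forall x : 'cV[R]_g, c * \sum_i x i 0 ^+ 2 <= (x^T *m A *m x) 0 0.
Proof.
(* In dimension 0 the sphere is empty, and the zero vector is the only one. *)
move=> Apos; have [g0|g0] := posnP g.
  exists 1 => // x; have -> : x = 0.
    by apply/colP => i; exfalso; move: (ltn_ord i); lia.
  rewrite mulmx0 mxE mul1r big1 // => i _; by rewrite mxE expr0n.
pose q (v : 'rV[R]_g) := (v *m A *m v^T) 0 0.
have qE v : q v = \sum_j (\sum_i v 0 i * A i j) * v 0 j.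
  by rewrite /q mxE; apply: eq_bigr => j _; rewrite !mxE.
pose S := [set v : 'rV[R]_g | `|v| = 1].
have normS (v : 'rV[R]_g) : v != 0 -> S (`|v|^-1 *: v).
  by move=> v0; rewrite /S /= normrZ normfV normr_id mulVf // normr_eq0.
have one0 : const_mx 1 != 0 :> 'rV[R]_g.
  apply/eqP => /rowP/(_ (Ordinal g0)); rewrite !mxE => /eqP.
  by rewrite oner_eq0.
have cptS : compact S.
  apply: bounded_closed_compact.
    exists 1; split=> // t t1 v; rewrite /S /= => ->; exact: ltW.
  apply: (@closed_comp _ _ (fun v : 'rV[R]_g => `|v|) [set 1]);
    last exact: closed_eq.
  by move=> v _; exact: norm_continuous.
have cq : {within S, continuous q}.
  apply: continuous_subspaceT => v.
  rewrite (_ : q = fun v => \sum_j (\sum_i v 0 i * A i j) * v 0 j); last first.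
    by apply/funext => w; exact: qE.
  apply: (cvg_big add_continuous (nbhs_filter v)) => j _.
  apply: cvgM; last exact: coord_continuous.
  apply: (cvg_big add_continuous (nbhs_filter v)) => i _.
  apply: cvgM; last exact: cvg_cst.
  exact: coord_continuous.
have [v vS qv] := EVT_min_rV (ex_intro _ _ (normS _ one0)) cptS cq.
have qpos : 0 < q v.
  rewrite /q -{1}[v]trmxK; apply: Apos; rewrite trmx_eq0 -normr_eq0.
  by move: vS; rewrite inE => ->; rewrite oner_eq0.
exists (q v / g%:R) => [|x]; first by rewrite divr_gt0 ?ltr0n.
have [->|x0] := eqVneq x 0.
  rewrite mulmx0 mxE big1 ?mulr0 // => i _; by rewrite mxE expr0n.
have xT0 : x^T != 0 by rewrite trmx_eq0.
have := qv (`|x^T|^-1 *: x^T); rewrite inE => /(_ (normS _ xT0)).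
rewrite {2}/q linearZ /= -scalemxAl -scalemxAl -scalemxAr !mxE trmxK mulrA -expr2.
rewrite exprVn mulrC ler_pdivlMr ?exprn_gt0 ?normr_gt0 // => h.
apply: le_trans h; rewrite -!mulrA ler_pM2l // ler_pdivrMl ?ltr0n //.
apply: (@le_trans _ _ (\sum_(i < g) `|x^T| ^+ 2)).
  apply: ler_sum => i _; rewrite -[leLHS]ger0_norm ?sqr_ge0 // normrX.
  rewrite ler_pXn2r ?nnegrE //.
  have -> : x i 0 = x^T 0 i by rewrite mxE.
  rewrite [leRHS]/Num.norm /= mx_normrE; exact: (le_bigmax _ _ (ord0, i)).
by rewrite sumr_const card_ord -[leLHS]mulr_natl.
Qed.

Lemma sum_geom_le (R : realType) (T : {fset nat}) :
  \sum_(k <- T) (2^-1 : R) ^+ k <= 2.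
Proof.
have e0 k : 0 <= (2^-1 : R) ^+ k by rewrite exprn_ge0 // invr_ge0.
pose N := (\max_(k : T) val k).+1.
apply: (@le_trans _ _ (\sum_(k <- [fset k in iota 0 N]%fset) (2^-1 : R) ^+ k)).
  apply: fsum_le_subset => //; apply/fsubsetP => k kA.
  by rewrite in_fset_iota ltnS; exact: (leq_bigmax [` kA]%fset).
rewrite big_fset_iota; elim: N => [|N IH].
  by rewrite big_geq.
rewrite big_nat_recl // expr0.
under eq_bigr do rewrite exprS.
by rewrite -mulr_sumr; lra.
Qed.

(** The absolute value is injective on the nonnegative and on the negative integers, so each half is
    at most a geometric sum over [nat]. *)
Lemma sum_geom_int_le (R : realType) (T : {fset int}) :
  \sum_(k <- T) (2^-1 : R) ^+ `|k|%N <= 4.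
Proof.
have half (P : pred int) : {in P &, injective absz} ->
    \sum_(k <- T | P k) (2^-1 : R) ^+ `|k|%N <= 2.
  move=> injP.
  have -> : \sum_(k <- T | P k) (2^-1 : R) ^+ `|k|%N =
      \sum_(m <- [fset `|k|%N | k in [fset k in T | P k]]%fset) (2^-1 : R) ^+ m.
    rewrite big_imfset /=; first by rewrite big_fset_condE.
    by move=> k l; rewrite !inE => /andP[_ Pk] /andP[_ Pl]; exact: injP.
  exact: sum_geom_le.
rewrite (bigID (fun k => 0 <= k)) /= (_ : 4 = 2 + 2); last by ring.
apply: lerD; apply: half => -[k|k] [l|l] //;
  by rewrite !unfold_in /= ?absz_nat ?NegzE => _ _; lia.
Qed.

Section Growth.
Variables (R : realType) (g : nat).
Local Notation C := R[i].
Implicit Types (n : 'cV[int]_g) (w : 'cV[C]_g) (P Q : 'cV[int]_g -> C).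

Definition norm1 n : R := \sum_i `|(n i 0)%:~R|.

Lemma norm1_ge0 n : 0 <= norm1 n.
Proof. by apply: sumr_ge0. Qed.

Lemma le_coord_norm1 n i : `|(n i 0)%:~R| <= norm1 n.
Proof. by rewrite /norm1 (bigD1 i) //= lerDl sumr_ge0. Qed.

(** The terms are products of one-variable factors [f], each dominated by a geometric term in
    [|k|]. *)
Lemma sum_gauss_le (c r : R) : 0 < c -> exists M, forall A : {fset 'cV[int]_g},
  \sum_(n <- A) expR (- (c * \sum_i (n i 0)%:~R ^+ 2) + r * norm1 n) <= M.
Proof.
(* [K] is the exponential of the maximum of [- c x^2 + (r + 1) x]; raising [r] by 1 leaves the
   decaying factor [expR (- |k|)]. *)
move=> c0; pose K := expR ((r + 1) ^+ 2 / (4 * c)).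
pose f (k : int) : R := expR (- (c * k%:~R ^+ 2) + r * `|k%:~R|).
have fle k : f k <= K * 2^-1 ^+ `|k|%N.
  have e2 : expR (- `|k%:~R|) <= (2^-1 : R) ^+ `|k|%N.
    rewrite -intr_norm -abszE expRN -(mul1r (_%:~R)) mulrC expRM_natl.
    rewrite exprVn lef_pV2.
    - rewrite lerXn2r ?nnegrE ?expR_ge0 //; apply: le_trans (expR_ge1Dx 1); lra.
    - by rewrite posrE exprn_gt0 // expR_gt0.
    - by rewrite posrE exprn_gt0.
  apply: (@le_trans _ _ (K * expR (- `|k%:~R|)));
    last by rewrite ler_pM2l ?expR_gt0.
  rewrite -expRD ler_expR -[k%:~R ^+ 2]real_normK ?num_real //.
  set x := `|_|; rewrite -subr_ge0.
  have -> : (r + 1) ^+ 2 / (4 * c) - x - (- (c * x ^+ 2) + r * x)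
      = c * (x - (r + 1) / (2 * c)) ^+ 2 by field; lra.
  by rewrite mulr_ge0 ?sqr_ge0 // ltW.
have fM (T : {fset int}) : \sum_(k <- T) f k <= K * 4.
  apply: le_trans (ler_wpM2l (ltW (expR_gt0 _)) (sum_geom_int_le R T)).
  by rewrite mulr_sumr; apply: ler_sum.
exists (\prod_(j < g) (K * 4)) => A.
pose e n : {ffun 'I_g -> int} := [ffun i => n i 0].
have einj : injective e.
  by move=> n m /ffunP nm; apply/colP => i; have := nm i; rewrite !ffunE.
rewrite (eq_bigr (fun n => \prod_i f (e n i))) => [|n _].
  have := @sum_prod_le g _ R (fun=> f) (fun=> K * 4) _ (fun=> fM)
    [fset e n | n in A]%fset.
  rewrite big_imfset /=; last by move=> n m _ _; exact: einj.
  by apply => j k; exact: expR_ge0.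
rewrite -expR_sum; congr expR; rewrite /norm1 !mulr_sumr -sumrN -big_split /=.
by apply: eq_bigr => i _; rewrite ffunE.
Qed.

Lemma eeD (z1 z2 : C) : ee (z1 + z2) = ee z1 * ee z2.
Proof. by rewrite /ee mulrDr expCD. Qed.

Lemma normc_ee (z : C) : normc (ee z) = expR (2 * pi * complex.Re z).
Proof. by rewrite /ee normc_expC; case: z => x y /=; rewrite mul0r subr0. Qed.

Lemma dotCDr (v w1 w2 : 'cV[C]_g) : dotC v (w1 + w2) = dotC v w1 + dotC v w2.
Proof. by rewrite /dotC mulmxDr mxE. Qed.

Lemma dotCE (v w : 'cV[C]_g) : dotC v w = \sum_i v i 0 * w i 0.
Proof. by rewrite /dotC mxE; apply: eq_bigr => i _; rewrite mxE. Qed.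

Lemma toCE n i : toC R n i 0 = ((n i 0)%:~R : R)%:C.
Proof. by rewrite mxE rmorph_int. Qed.

Lemma gauss_termD w1 w2 B n :
  gauss_term (w1 + w2) B n = gauss_term w1 B n * ee (dotC (toC R n) w2).
Proof. by rewrite /gauss_term dotCDr addrA eeD. Qed.

Lemma normc_dotC_le w n :
  normc (dotC (toC R n) w) <= (\sum_i normc (w i 0)) * norm1 n.
Proof.
rewrite dotCE mulr_suml; apply: le_trans (normc_sum _ _ _) _.
apply: ler_sum => i _; rewrite normcM toCE normc_real mulrC.
rewrite ler_wpM2l ?normc_ge0 //.
exact: le_coord_norm1.
Qed.

(** The modulus of [ee z] depends only on [Re z], and for real [n] the real part of [n^t B n] is the
    form of [Re B]. The factor [2 pi] times one half gives the constant [pi * c]. *)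
Lemma normc_gauss_term_le B : siegel B -> exists2 c : R, 0 < c &
  forall n, normc (gauss_term 0 B n) <= expR (- (c * \sum_i (n i 0)%:~R ^+ 2)).
Proof.
move=> [_ Bpos]; have [c c0 cB] := posdef_ge Bpos.
exists (pi * c) => [|n]; first by rewrite mulr_gt0 ?pi_gt0.
rewrite normc_ee ler_expR.
pose x : 'cV[R]_g := map_mx intr n.
have -> : complex.Re (- 2^-1 * ((toC R n)^T *m B *m toC R n) 0 0
      + dotC (toC R n) 0)
   = - 2^-1 * (x^T *m map_mx (@complex.Re R) B *m x) 0 0.
  have -> : dotC (toC R n) 0 = 0 by rewrite /dotC mulmx0 mxE.
  have -> : - 2^-1 = (- 2^-1 : R)%:C :> C by rewrite rmorphN fmorphV rmorph_nat.
  rewrite addr0; set q := (X in _ * X); set q' := (X in _ = _ * X).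
  have -> : q' = complex.Re q.
    rewrite /q /q' !mxE raddf_sum; apply: eq_bigr => j _.
    have intC (k : int) : (k%:~R : C) = (k%:~R : R)%:C by rewrite rmorph_int.
    rewrite !mxE intC mulr_suml mulr_suml raddf_sum; apply: eq_bigr => i _.
    rewrite !mxE intC; case: (B i j) => a b /=; simpc => /=; ring.
  by case: q => a b; simpc.
have := cB x.
have -> : \sum_i x i 0 ^+ 2 = \sum_i (n i 0)%:~R ^+ 2.
  by apply: eq_bigr => i _; rewrite mxE.
move=> /(ler_wpM2l (pi_ge0 R)) h.
rewrite -mulrA; move: h; set q := (_ *m _ *m _) _ _; lra.
Qed.

(** The admissible weights of theta series: the class contains coordinates and real exponentials and
    is closed under products, so termwise differentiation stays inside it. *)
Definition exp_growth P :=
  exists K r : R, forall n, normc (P n) <= K * expR (r * norm1 n).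

(** Passing from parameter 0 to [w] costs at most [expR (2 pi s |n|)], with [s] the sum of the
    [|w_i|]. Together with the growth of [P] the exponent stays linear in [norm1 n], and the
    quadratic decay wins. *)
Lemma exp_growth_gauss B w P : siegel B -> exp_growth P ->
  exists M, forall A : {fset 'cV[int]_g},
    \sum_(n <- A) normc (P n * gauss_term w B n) <= M.
Proof.
move=> Bs [K [r PK]]; have [c c0 cB] := normc_gauss_term_le Bs.
have [M hM] := sum_gauss_le (r + 2 * pi * \sum_i normc (w i 0)) c0.
exists (K * M) => A.
(* The growth bound at [n = 0] forces [K] to be nonnegative. *)
have K0 : 0 <= K.
  by have := le_trans (normc_ge0 _) (PK 0); rewrite pmulr_lge0 ?expR_gt0.
apply: le_trans (ler_wpM2l K0 (hM A)); rewrite mulr_sumr; apply: ler_sum => n _.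
rewrite -{1}[w]add0r gauss_termD !normcM.
set s := \sum_i normc (w i 0); set G := c * _.
have -> : K * expR (- G + (r + 2 * pi * s) * norm1 n)
    = K * expR (r * norm1 n) * (expR (- G) * expR (2 * pi * s * norm1 n)).
  by rewrite -[RHS]mulrA -!expRD; congr (_ * expR _); ring.
apply: ler_pM; rewrite ?normc_ge0 ?mulr_ge0 ?normc_ge0 //.
apply: ler_pM; rewrite ?normc_ge0 //.
rewrite normc_ee ler_expR -[leRHS]mulrA.
apply: ler_wpM2l; first by rewrite mulr_ge0 ?pi_ge0.
exact: le_trans (le_Re_normc _) (normc_dotC_le _ _).
Qed.

Lemma le_expR (x : R) : x <= expR x.
Proof. by apply: le_trans (expR_ge1Dx x); rewrite lerDr. Qed.

Lemma exp_growthM P Q :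
  exp_growth P -> exp_growth Q -> exp_growth (fun n => P n * Q n).
Proof.
move=> [K [r hP]] [L [s hQ]]; exists (K * L), (r + s) => n.
by rewrite normcM mulrDl expRD mulrACA; apply: ler_pM; rewrite ?normc_ge0.
Qed.

Lemma exp_growth_cst (z : C) : exp_growth (fun=> z).
Proof. by exists (normc z), 0 => n; rewrite mul0r expR0 mulr1. Qed.

Lemma exp_growth_coord i : exp_growth (fun n => toC R n i 0).
Proof.
exists 1, 1 => n; rewrite !mul1r toCE normc_real.
exact: le_trans (le_coord_norm1 _ _) (le_expR _).
Qed.

Lemma exp_growth_prod (J : Type) (s : seq J) (Ps : J -> 'cV[int]_g -> C) :
  (forall j, exp_growth (Ps j)) -> exp_growth (fun n => \prod_(j <- s) Ps j n).
Proof.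
move=> hP; elim: s => [|j s IH].
  by rewrite (_ : (fun _ => _) = fun=> 1) //; [exact: exp_growth_cst |
    apply/funext => n; rewrite big_nil].
rewrite (_ : (fun _ => _) = fun n => Ps j n * \prod_(j <- s) Ps j n).
  exact: exp_growthM.
by apply/funext => n; rewrite big_cons.
Qed.

Lemma exp_growthX P k : exp_growth P -> exp_growth (fun n => P n ^+ k).
Proof.
move=> hP; rewrite (_ : (fun _ => _) = fun n => \prod_(i <- iota 0 k) P n).
  exact: exp_growth_prod.
apply/funext => n.
by rewrite big_const_seq count_predT size_iota -Monoid.iteropE.
Qed.

Lemma exp_growth_expR (r : R) : exp_growth (fun n => (expR (r * norm1 n))%:C).
Proof.
by exists 1, r => n; rewrite mul1r normc_real ger0_norm ?expR_ge0.
Qed.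

End Growth.

(** * Termwise differentiation of theta series *)

Section ThetaSums.
Variables (R : realType) (g : nat) (B : 'M[R[i]]_g).
Hypothesis siegelB : siegel B.
Local Notation C := R[i].
Local Notation twopi := ((2 * pi)%:C : C).
Implicit Types (n : 'cV[int]_g) (w : 'cV[C]_g) (P Q : 'cV[int]_g -> C).

(** Theta series with a weight [P]; theta is the case [P = 1], and differentiation in [w] changes
    only the weight. *)
Definition theta_sum P w : C := csum (fun n => P n * gauss_term w B n).

Lemma has_sum_theta P w : exp_growth P ->
  has_sum (fun n => P n * gauss_term w B n) (theta_sum P w).
Proof.
move=> hP; have [M hM] := exp_growth_gauss w siegelB hP.
by have [s hs] := normc_has_sum hM; rewrite /theta_sum (has_sum_csum hs).
Qed.

Lemma dotC_delta n j (h : C) :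
  dotC (toC R n) (h *: delta_mx j 0) = h * toC R n j 0.
Proof.
rewrite dotCE (bigD1 j) //= !mxE !eqxx mulr1 mulrC big1 ?addr0 // => i ij.
by rewrite !mxE (negPf ij) !mulr0.
Qed.

(** The candidate derivative minus the difference quotient is again a sum over [n], whose terms
    contain second-order Taylor remainders of the exponential; it is therefore at most [|h| * M]. *)
Lemma pderiv_theta_sum P j w : exp_growth P ->
  pderiv j (theta_sum P) w = theta_sum (fun n => twopi * toC R n j 0 * P n) w.
Proof.
move=> hP; set Q := fun n => _.
have hQ : exp_growth Q.
  apply: exp_growthM => //; apply: exp_growthM; first exact: exp_growth_cst.
  exact: exp_growth_coord.
(* With [|n_j| <= |n|] and [|h| < 1], the factor [|2 pi n_j|^2] of the remainder costs [4 pi] in the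
   exponent and its exponential another [2 pi]. *)
have [M hM] := exp_growth_gauss w siegelB
  (exp_growthM hP (@exp_growth_expR R g (6 * pi))).
rewrite /pderiv /derive.
apply: (@cvg_lim (C : numFieldType)^o); first exact: norm_hausdorff.
apply/cvg_normcP => e e0.
(* The bound 1 on [|h|] serves the Taylor estimate; the quotient makes [|h| * M] smaller than [e],
   with [|M| + 1] as a positive divisor. *)
have d0 : 0 < Num.min 1 (e / (`|M| + 1)).
  by rewrite lt_min ltr01 divr_gt0 // ltr_wpDl.
have d0' : 0 < (Num.min 1 (e / (`|M| + 1)))%:C :> C by rewrite ltcR.
have H1 := @dnbhs0_lt (C : numFieldType) (C : numFieldType) _ d0'.
have H2 := nbhs_dnbhs_neq (0 : (C : numFieldType)).
apply: filterS2 H1 H2 => h.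
move=> hlt h0; have : normc h < Num.min 1 (e / (`|M| + 1)) by rewrite -ltcR.
rewrite lt_min => /andP[h1 hM1].
have hn0 : 0 < normc h.
  by rewrite lt_def normc_ge0 andbT; apply: contraNneq h0 => /eq0_normc ->.
apply: (@le_lt_trans _ _ (normc h * M)); last first.
  apply: (@le_lt_trans _ _ (normc h * (`|M| + 1))).
    by rewrite ler_pM2l // (le_trans (ler_norm M)) // lerDl.
  by rewrite -ltr_pdivlMr // ltr_wpDl.
(* An increment [h] in direction [j] multiplies the [n]-th Gaussian term by [expC (h * a n)]. *)
pose a n := twopi * toC R n j 0.
apply: (@normc_has_sum_le _ _ (fun n => h^-1 * (P n * gauss_term w B n)
    * - (expC (h * a n) - 1 - h * a n))) => [A|]; last first.
  have H := has_sumB (@has_sum_theta _ w hQ)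
    (@has_sumZ _ _ h^-1 _ _
      (has_sumB (@has_sum_theta _ (h *: delta_mx j 0 + w) hP)
        (@has_sum_theta _ w hP))).
  apply: eq_has_sum H => n.
  rewrite [_ *: _ + w]addrC gauss_termD dotC_delta /ee /Q -/(a n).
  rewrite [twopi * (h * _)]mulrCA -/(a n); field.
  exact: h0.
apply: le_trans (ler_wpM2l (ltW hn0) (hM A)); rewrite mulr_sumr.
apply: ler_sum => n _.
have aE : normc (a n) <= 2 * pi * norm1 R n.
  rewrite normcM toCE !normc_real ger0_norm ?mulr_ge0 ?pi_ge0 //.
  by rewrite ler_wpM2l ?mulr_ge0 ?pi_ge0 // le_coord_norm1.
have xE : normc (expC (h * a n) - 1 - h * a n)
    <= normc h ^+ 2 * expR (6 * pi * norm1 R n).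
  apply: le_trans (expC_taylor2 _) _; rewrite normcM exprMn -[leLHS]mulrA.
  apply: ler_wpM2l; first exact: sqr_ge0.
  have -> : expR (6 * pi * norm1 R n)
      = expR (2 * pi * norm1 R n) ^+ 2 * expR (2 * pi * norm1 R n).
    by rewrite -exprSr -expRM_natl; congr expR; ring.
  apply: ler_pM; rewrite ?sqr_ge0 ?expR_ge0 //.
    rewrite lerXn2r ?nnegrE ?normc_ge0 ?expR_ge0 //.
    exact: le_trans aE (le_expR _).
  rewrite ler_expR; apply: le_trans aE.
  by rewrite ler_piMl ?normc_ge0 // ltW.
rewrite !normcM normcN normcV normc_real (ger0_norm (expR_ge0 _)).
apply: le_trans (ler_wpM2l _ xE) _.
  by rewrite !mulr_ge0 ?invr_ge0 ?normc_ge0.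
rewrite le_eqVlt; apply/orP; left; apply/eqP; field.
by rewrite gt_eqF.
Qed.

Lemma exp_growth_scaled_coord j : exp_growth (fun n => twopi * toC R n j 0).
Proof. by apply: exp_growthM; [exact: exp_growth_cst|exact: exp_growth_coord]. Qed.

Lemma foldr_pderiv_theta_sum (s : seq 'I_g) :
  foldr (@pderiv _ g) (fun w => theta w B) s
  = theta_sum (fun n => \prod_(j <- s) (twopi * toC R n j 0)).
Proof.
elim: s => [|j s IH].
  by apply/funext => w; apply: eq_csum => n; rewrite big_nil mul1r.
apply/funext => w; rewrite /= IH pderiv_theta_sum; last first.
  by apply: exp_growth_prod => i; exact: exp_growth_scaled_coord.
by apply: eq_csum => n; rewrite big_cons.
Qed.

Lemma prod_mseq (K : fieldType) (a : mindex g) (f : 'I_g -> K) :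
  \prod_(j <- mseq a) f j = \prod_j f j ^+ a j.
Proof.
rewrite /mseq big_flatten big_map -big_enum /=; apply: eq_bigr => j _.
by rewrite big_nseq -Monoid.iteropE.
Qed.

Lemma mpow_scale (K : fieldType) (c : K) (v : 'cV[K]_g) (a : mindex g) :
  mpow (c *: v) a = c ^+ mdeg a * mpow v a.
Proof.
rewrite /mpow /mdeg -prodrXr -big_split /=; apply: eq_bigr => i _.
by rewrite mxE exprMn.
Qed.

(** Each of the [mdeg a] derivatives inserts a factor [2 pi n_j]; the constants move in front and
    leave the monomial as weight. *)
Lemma Dmulti_theta (a : mindex g) w :
  Dmulti a (fun w => theta w B) w
  = twopi ^+ mdeg a * theta_sum (monomial R a) w.
Proof.
rewrite /Dmulti foldr_pderiv_theta_sum.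
have hm : exp_growth (monomial R a).
  by apply: exp_growth_prod => j; apply: exp_growthX; exact: exp_growth_coord.
have H := @has_sumZ _ _ (twopi ^+ mdeg a) _ _ (@has_sum_theta _ w hm).
apply: has_sum_csum; apply: eq_has_sum H => n.
rewrite prod_mseq mulrA /monomial -mpow_scale; congr (_ * _).
by apply: eq_bigr => j _; rewrite mxE.
Qed.

End ThetaSums.

Section ChainRule.
Variables (K : numFieldType) (g : nat).
Implicit Types (f : 'cV[K]_g -> K).

(* The limit of a divergent function is the junk value [point]; as this is 0,
   no convergence has to be assumed. *)
Lemma limM_cst (T : Type) (F : set_system T) (FF : ProperFilter F) (c : K)
    (f : T -> K^o) : point = 0 :> K^o -> c != 0 ->
  lim ((fun x => c * f x : K^o) @ F) = c * lim (f @ F).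
Proof.
move=> p0 c0; have [cf|ncf] := pselect (cvg (f @ F)).
  apply: (@cvg_lim K^o); first exact: norm_hausdorff.
  by apply: cvgM; [exact: cvg_cst|exact: cf].
rewrite (dvgP ncf) p0 mulr0; apply: etrans p0; apply: dvgP => cf; apply: ncf.
have -> : f = fun x => c^-1 * (c * f x) by apply/funext => x; rewrite mulKf.
by apply: is_cvgM; [exact: is_cvg_cst|exact: cf].
Qed.

End ChainRule.

(** * Affine changes of variables *)

Lemma size_mseq (g : nat) (a : mindex g) : size (mseq a) = mdeg a.
Proof.
rewrite /mseq size_flatten /shape -map_comp sumnE big_map big_enum /=.
by apply: eq_bigr => i _; rewrite size_nseq.
Qed.

Section ChainRule.
Variables (R : realType) (g : nat).
Local Notation C := (R[i] : numFieldType).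
Implicit Types (f : 'cV[C]_g -> C).

Lemma dnbhs0_scale_sub (c : C) : c != 0 -> (fun h : C => c * h) @ 0^' `=>` 0^'.
Proof.
move=> c0 A; rewrite /dnbhs /within /= => A0.
have cc : (fun h : C => c * h) @ 0 --> c * 0.
  exact: mulrl_continuous.
rewrite mulr0 in cc.
have cA : nbhs (0 : C) (fun h => c * h != 0 -> A (c * h)) := cc _ A0.
change (nbhs (0 : C) (fun h => h != 0 -> A (c * h))).
apply: filterS cA => h hA h0.
by apply: hA; rewrite mulf_neq0.
Qed.

(** Multiplication by [c] and by its inverse both preserve punctured neighbourhoods of 0. Equality
    of the filters, more than an inclusion, equates limits even where they are default values. *)
Lemma dnbhs0_scale (c : C) : c != 0 -> (fun h : C => c * h) @ 0^' = 0^'.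
Proof.
move=> c0; apply/seteqP; split; last exact: dnbhs0_scale_sub.
move=> A cA; have ci0 : c^-1 != 0 by rewrite invr_eq0.
have : (0 : C)^' (fun h => A (c * (c^-1 * h))) := dnbhs0_scale_sub ci0 cA.
suff -> : (fun h => A (c * (c^-1 * h))) = A by [].
by apply/funext => h; rewrite mulVKf.
Qed.

(** The quotient with increment [h] is [k * c] times the quotient of [f] at [u + c v] with increment
    [c h]. Where it diverges, both sides are the default value 0. *)
Lemma pderiv_affine (j : 'I_g) f (u : 'cV[C]_g) (k c : C) : k != 0 -> c != 0 ->
  pderiv j (fun v => k * f (u + c *: v)) =
  fun v => k * c * pderiv j f (u + c *: v).
Proof.
move=> k0 c0; apply/funext => v; rewrite /pderiv /derive.
pose G (h : C) : C^o :=
  h^-1 *: ((f : _ -> C^o) (h *: delta_mx j 0 + (u + c *: v)) - f (u + c *: v)).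
have -> : (fun h : C => h^-1 *: (((fun v => k * f (u + c *: v) : C^o) \o shift v)
      (h *: delta_mx j 0) - (k * f (u + c *: v) : C^o)))
    = (fun h => (k * c) * (G \o (fun h => c * h)) h).
  apply/funext => h; rewrite /G /=.
  have -> : u + c *: (h *: delta_mx j 0 + v)
      = (c * h) *: delta_mx j 0 + (u + c *: v).
    by rewrite scalerDr scalerA addrCA.
  rewrite /GRing.scale /= invfM.
  by set hi := h^-1; field; exact: c0.
have kc0 : k * c != 0 by rewrite mulf_neq0.
(* Here [erefl] checks that the default value of the field is 0. *)
rewrite (@limM_cst C _ _ _ (k * c) (G \o (fun h => c * h)) erefl kc0).
have E : (G \o (fun h => c * h)) @ (0 : C)^' = G @ (0 : C)^'.
  by rewrite -[in RHS](dnbhs0_scale c0).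
by rewrite E.
Qed.

Lemma Dmulti_affine (a : mindex g) f (u : 'cV[C]_g) (k c : C) :
  k != 0 -> c != 0 ->
  Dmulti a (fun v => k * f (u + c *: v)) =
  fun v => k * c ^+ mdeg a * Dmulti a f (u + c *: v).
Proof.
move=> k0 c0; rewrite /Dmulti -size_mseq.
elim: (mseq a) => [|j s IH] /=; first by rewrite mulr1.
by rewrite IH pderiv_affine ?mulf_neq0 ?expf_neq0 // exprSr mulrA.
Qed.

(** The constant [k] cancels in the innermost quotient [f' / f], and every derivative contributes
    one factor [c]. *)
Lemma Dlog_affine (a : mindex g) f (u : 'cV[C]_g) (k c : C) :
  k != 0 -> c != 0 ->
  Dlog a (fun v => k * f (u + c *: v)) =
  fun v => c ^+ mdeg a * Dlog a f (u + c *: v).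
Proof.
move=> k0 c0; rewrite /Dlog -size_mseq.
elim: (mseq a) => [|j [|j' s] IH].
(* For the empty sequence both sides are the dummy value 0. *)
- by apply/funext => v; rewrite mulr0.
- apply/funext => v /=; rewrite pderiv_affine // expr1 invfM.
  rewrite mulrACA -[k * c / k]mulrAC divff // mul1r mulrA //.
(* The inner logarithmic derivative is itself an affine pullback, with a power of [c] in the place
   of [k]. *)
- rewrite -[Dlog_seq [:: j, j' & s] _]/(pderiv j (Dlog_seq (j' :: s) _)) IH.
  by rewrite pderiv_affine ?expf_neq0 // -exprSr.
Qed.

End ChainRule.

(** * The binomial formula for multi-indices *)

Section MultiBinomial.
Variables (K : numFieldType) (g : nat).
Implicit Types a b : mindex g.

Lemma mbinomE a b : mle b a -> mbinom K a b = \prod_i ('C(a i, b i))%:R.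
Proof.
move=> ba; rewrite /mbinom /mfact -natrM -big_split /=.
have -> : (\prod_i (a i)`!
    = \prod_i 'C(a i, b i) * \prod_i ((b i)`! * (msub a b i)`!))%N.
  rewrite -big_split /=; apply: eq_bigr => i _.
  by rewrite ffunE bin_fact.
rewrite natrM mulfK; last first.
  by rewrite pnatr_eq0 -lt0n prodn_gt0 // => i; rewrite muln_gt0 !fact_gt0.
by rewrite natr_prod.
Qed.

(** Finiteness turns the sum over this classical set into an ordinary finite sum. *)
Lemma finite_mle a : finite_set [set b | mle b a].
Proof.
apply: (@sub_finite_set _ _
  [set` fset_box g [fset k in iota 0 (\max_i a i).+1]%fset]);
  last exact: finite_fset.
move=> b ba; apply/mem_fset_box => i; rewrite in_fset_iota ltnS.
apply: leq_trans (ba i) _; exact: leq_bigmax.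
Qed.

(** Multiply the binomial expansions of the coordinates and expand the product over a box. *)
Lemma mpowD (x y : 'cV[K]_g) a :
  mpow (x + y) a = \sum_(b \in [set b | mle b a])
    mbinom K a b * mpow x (msub a b) * mpow y b.
Proof.
(* A common range below [N] for all coordinates makes the index set a box; the extra terms vanish
   with their binomial coefficients. *)
pose N := (\max_i a i).+1; pose T := [fset k in iota 0 N]%fset.
pose f i k := 'C(a i, k)%:R * x i 0 ^+ (a i - k) * y i 0 ^+ k.
transitivity (\sum_(b <- fset_box g T) \prod_i f i (b i)).
  rewrite sum_fset_box; apply: eq_bigr => i _.
  rewrite /T big_fset_iota mxE exprDn big_mkord.
  have aN : ((a i).+1 <= N)%N by rewrite ltnS; exact: leq_bigmax.
  rewrite (big_ord_widen _
    (fun k => (x i 0 ^+ (a i - k) * y i 0 ^+ k) *+ 'C(a i, k)) aN).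
  rewrite big_mkcond /=; apply: eq_bigr => k _; rewrite /f -mulrA mulr_natl.
  by case: ltnP => // ak; rewrite bin_small.
rewrite fsbig_finite /=; last exact: finite_mle.
have memA b : (b \in fset_set [set b | mle b a]) = (b \in [set b | mle b a]).
  by rewrite in_fset_set //; exact: finite_mle.
rewrite -(@big_fset_incl _ _ _ _ (fset_set [set b | mle b a])) /=.
- rewrite big_seq [RHS]big_seq; apply: eq_bigr => b; rewrite memA inE /= => ba.
  rewrite mbinomE // /mpow -!big_split /=; apply: eq_bigr => i _.
  by rewrite /f ffunE.
- apply/fsubsetP => b; rewrite memA inE /= => ba; apply/mem_fset_box => i.
  rewrite in_fset_iota ltnS; apply: leq_trans (ba i) _; exact: leq_bigmax.
- move=> b _; rewrite memA => /negP; rewrite inE /= => nba.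
  have [i bai] : exists i, (a i < b i)%N.
    apply: contrapT => H; apply: nba => i; rewrite leqNgt; apply/negP => ab.
    by apply: H; exists i.
  by rewrite (bigD1 i) //= /f bin_small // !mul0r.
Qed.

Lemma mdeg_msub a b : mle b a -> (mdeg (msub a b) + mdeg b)%N = mdeg a.
Proof.
move=> ba; rewrite /mdeg -big_split /=; apply: eq_bigr => i _.
by rewrite ffunE subnK.
Qed.

End MultiBinomial.

(** * Moments and characteristic function *)

Section DiscreteGaussian.
Variables (R : realType) (g : nat) (u : 'cV[R[i]]_g) (B : 'M[R[i]]_g).
Hypothesis siegelB : siegel B.
Local Notation C := (R[i] : numFieldType).
Local Notation twopi := ((2 * pi)%:C : C).
Local Notation th := (fun w : 'cV[C]_g => theta w B).
Local Notation p := (dgauss u B).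
Hypothesis th0 : th u != 0.

Lemma twopi_neq0 : twopi != 0.
Proof.
rewrite -(rmorph0 (real_complex R)) (inj_eq (@complexI R)).
by rewrite mulf_neq0 ?pnatr_eq0 // gt_eqF ?pi_gt0.
Qed.

Lemma has_sum_Eterm (P : 'cV[int]_g -> R[i]) : exp_growth P ->
  has_sum (Eterm p P) ((th u)^-1 * theta_sum B P u).
Proof.
move=> hP.
have H := @has_sumZ _ _ (th u)^-1 _ _ (@has_sum_theta _ _ _ siegelB P u hP).
by apply: eq_has_sum H => n; rewrite /Eterm /dgauss mulrCA.
Qed.

Lemma ExpE (P : 'cV[int]_g -> R[i]) : exp_growth P ->
  Exp p P = (th u)^-1 * theta_sum B P u.
Proof. by move=> hP; apply: has_sum_csum; exact: has_sum_Eterm. Qed.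

Lemma Eterm_expmgf (v : 'cV[C]_g) (n : 'cV[int]_g) :
  Eterm p (expmgf v) n = (th u)^-1 * gauss_term (u + twopi^-1 *: v) B n.
Proof.
have E : ee (dotC (toC R n) (twopi^-1 *: v)) = expmgf v n.
  rewrite /expmgf /ee !dotCE mulr_sumr; congr expC; apply: eq_bigr => i _.
  have -> : (twopi^-1 *: v) i 0 = twopi^-1 * v i 0 by rewrite mxE.
  by rewrite mulrCA mulVKf ?twopi_neq0 // mulrC.
by rewrite /Eterm /dgauss gauss_termD E mulrCA [expmgf v n * _]mulrC.
Qed.

Lemma has_sum_expmgf (v : 'cV[C]_g) :
  has_sum (Eterm p (expmgf v)) ((th u)^-1 * th (u + twopi^-1 *: v)).
Proof.
have h1 : exp_growth (fun _ : 'cV[int]_g => 1 : R[i]) by exact: exp_growth_cst.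
have H := @has_sumZ _ _ (th u)^-1 _ _
  (@has_sum_theta _ _ _ siegelB _ (u + twopi^-1 *: v) h1).
have -> : th (u + twopi^-1 *: v) = theta_sum B (fun=> 1) (u + twopi^-1 *: v).
  by apply: eq_csum => n; rewrite mul1r.
by apply: eq_has_sum H => n; rewrite Eterm_expmgf mul1r.
Qed.

Lemma expchar_mgf (v : 'cV[C]_g) : expchar v = expmgf ('i%C *: v).
Proof.
apply/funext => n; rewrite /expchar /expmgf !dotCE mulr_sumr; congr expC.
apply: eq_bigr => i _.
have -> : ('i%C *: v) i 0 = 'i%C * v i 0 by rewrite mxE.
by rewrite mulrA.
Qed.

Lemma has_sum_charfun (v : 'cV[C]_g) :
  has_sum (Eterm p (expchar v)) (th (u + ('i%C / twopi) *: v) / th u).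
Proof.
have -> : ('i%C / twopi) *: v = twopi^-1 *: ('i%C *: v).
  by rewrite scalerA mulrC.
by rewrite expchar_mgf mulrC; exact: has_sum_expmgf.
Qed.

Lemma exp_growth_monomial (a : mindex g) : exp_growth (monomial R a).
Proof.
by apply: exp_growth_prod => j; apply: exp_growthX; exact: exp_growth_coord.
Qed.

Lemma momentE (a : mindex g) :
  moment p a = (twopi ^+ mdeg a)^-1 * (th u)^-1 * Dmulti a th u.
Proof.
rewrite /moment ExpE; last exact: exp_growth_monomial.
rewrite Dmulti_theta //; field.
by rewrite th0 expf_neq0 // twopi_neq0.
Qed.

Lemma meanE : mean p = (twopi * th u)^-1 *: grad th u.
Proof.
apply/colP => j; rewrite !mxE ExpE; last exact: exp_growth_coord.
have /(congr1 (fun f => f u)) /= -> :=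
  @foldr_pderiv_theta_sum R g B siegelB [:: j].
set c := fun n => toC R n j 0.
have H := @has_sumZ _ _ twopi _ _
  (@has_sum_theta _ _ _ siegelB _ u (@exp_growth_coord R g j)).
rewrite (_ : theta_sum _ (fun n => \prod_(i <- _) _) u = twopi * theta_sum B c u).
  by rewrite invfM mulrACA mulVf ?twopi_neq0 // mul1r.
by apply: has_sum_csum; apply: eq_has_sum H => n; rewrite big_seq1 mulrA.
Qed.

Lemma cmonomialE (a : mindex g) (n : 'cV[int]_g) :
  Eterm p (cmonomial p a) n = \sum_(b <- fset_set [set b | mle b a])
    mbinom R[i] a b * mpow (- mean p) b * Eterm p (monomial R (msub a b)) n.
Proof.
rewrite /Eterm /cmonomial mpowD fsbig_finite /=; last exact: finite_mle.
by rewrite mulr_suml; apply: eq_bigr => b _; rewrite /monomial; ring.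
Qed.

(** Expanding a power of [X - mean p] gives finitely many moments, so the sum over [n] may be taken
    term by term. *)
Lemma has_sum_cmonomial (a : mindex g) :
  has_sum (Eterm p (cmonomial p a)) ((twopi ^+ mdeg a)^-1 * (th u)^-1 *
         \sum_(b \in [set b : mindex g | mle b a])
           (mbinom R[i] a b * ((-1) ^+ mdeg b / th u ^+ mdeg b)
             * mpow (grad th u) b * Dmulti (msub a b) th u)).
Proof.
pose s b := mbinom R[i] a b * mpow (- mean p) b * moment p (msub a b).
have H : has_sum (Eterm p (cmonomial p a))
    (\sum_(b <- fset_set [set b | mle b a]) s b).
  have H b : has_sum (fun n => mbinom R[i] a b * mpow (- mean p) b
      * Eterm p (monomial R (msub a b)) n) (s b).
    apply: has_sumZ; rewrite /moment ExpE; last exact: exp_growth_monomial.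
    by apply: has_sum_Eterm; exact: exp_growth_monomial.
  apply: eq_has_sum
    (@has_sum_sum _ _ _ (fset_set [set b | mle b a]) _ _ H) => n.
  by rewrite cmonomialE.
rewrite fsbig_finite /=; last exact: finite_mle.
rewrite (_ : _ * _ = \sum_(b <- fset_set [set b | mle b a]) s b) //.
rewrite mulr_sumr big_seq [RHS]big_seq; apply: eq_bigr => b.
rewrite in_fset_set; last exact: finite_mle.
rewrite inE /= => ba; rewrite /s momentE meanE -scaleNr mpow_scale.
have -> : (- (twopi * th u)^-1) ^+ mdeg b
    = (-1) ^+ mdeg b / (twopi ^+ mdeg b * th u ^+ mdeg b).
  by rewrite -exprMn -exprVn -exprMn mulN1r.
(* The mean contributes [|b|] factors [1 / (2 pi)] and the moment [|a - b|] of them, in total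
   [|a|]. *)
rewrite -(mdeg_msub ba) exprD.
have : twopi ^+ mdeg b != 0 by rewrite expf_neq0 // twopi_neq0.
have : twopi ^+ mdeg (msub a b) != 0 by rewrite expf_neq0 // twopi_neq0.
have : th u ^+ mdeg b != 0 by rewrite expf_neq0.
move: (twopi ^+ _) (twopi ^+ _) (th u ^+ _) => x y z z0 y0 x0; field.
by rewrite x0 y0 z0 th0.
Qed.

End DiscreteGaussian.

(** * Power series expansion of the characteristic function *)

Section CharacteristicFunction.
Variables (R : realType) (g : nat) (u : 'cV[R[i]]_g) (B : 'M[R[i]]_g).
Hypothesis siegelB : siegel B.
Local Notation C := (R[i] : numFieldType).
Local Notation th := (fun w : 'cV[C]_g => theta w B).
Local Notation p := (dgauss u B).
Hypothesis th0 : th u != 0.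

Lemma expcharE (v : 'cV[C]_g) (n : 'cV[int]_g) :
  expchar v n = expC (\sum_j 'i%C * (v j 0 * toC R n j 0)).
Proof. by rewrite /expchar dotCE mulr_sumr. Qed.

Lemma prod_exp_term (v : 'cV[C]_g) (n : 'cV[int]_g) (a : mindex g) :
  \prod_j exp_term ('i%C * (v j 0 * toC R n j 0)) (a j)
  = 'i%C ^+ mdeg a / (mfact a)%:R * mpow v a * monomial R a n.
Proof.
rewrite /monomial /mpow /mfact natr_prod -prodfV /mdeg -prodrXr -!big_split /=.
by apply: eq_bigr => j _; rewrite /exp_term !exprMn; ring.
Qed.

(** Summation over [a] and expectation over [n] are exchanged by dominated convergence, along the
    filter of finite sets of multi-indices. *)
Lemma has_sum_charfun_fps (v : 'cV[C]_g) :
  has_sum (fun a : mindex g => charfun_fps p a * mpow v a) (charfun p v).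
Proof.
pose z n j := 'i%C * (v j 0 * toC R n j 0) : R[i].
pose T (A : {fset mindex g}) n := \sum_(a <- A) \prod_j exp_term (z n j) (a j).
(* [d A n] is the error at [n] of truncating the exponential series to [A]; its sum over [n] is the
   error of the partial power series. *)
pose d A n := Eterm p (expchar v) n - Eterm p (T A) n.
pose r := \sum_j normc (v j 0).
(* The factor 2 accounts for the exponential and its truncation, each at most [expR (r |n|)] in
   modulus. *)
pose G n :=
  normc ((th u)^-1 * (2 * (expR (r * norm1 R n))%:C) * gauss_term u B n).
have zr n : \sum_j normc (z n j) <= r * norm1 R n.
  rewrite /r mulr_suml; apply: ler_sum => j _.
  rewrite /z !normcM toCE normc_real.
  rewrite [normc 'i%C]/= expr0n expr1n add0r sqrtr1 mul1r.
  by rewrite ler_wpM2l ?normc_ge0 // le_coord_norm1.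
have [M hM] : exists M, forall A : {fset 'cV[int]_g}, \sum_(n <- A) G n <= M.
  apply: exp_growth_gauss siegelB _.
  apply: exp_growthM; first exact: exp_growth_cst.
  by apply: exp_growthM; [exact: exp_growth_cst|exact: exp_growth_expR].
have dG A n : normc (d A n) <= G n.
  rewrite /d /Eterm -mulrBl /G /dgauss !normcM.
  rewrite [normc (expR _)%:C]normc_real normc_nat (ger0_norm (expR_ge0 _)).
  rewrite mulrA [X in X * normc (gauss_term _ _ _) <= _]mulrC.
  apply: ler_wpM2r; first exact: normc_ge0.
  apply: ler_wpM2l; first exact: normc_ge0.
  apply: le_trans (le_normcD _ _) _; rewrite normcN mulr_natl mulr2n.
  apply: lerD.
    rewrite expcharE normc_expC ler_expR; apply: le_trans (le_Re_normc _) _.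
    by apply: le_trans (normc_sum _ _ _) (zr n).
  apply: le_trans (normc_sum _ _ _) _.
  apply: le_trans (sum_exp_mindex_le _ _) _.
  by rewrite ler_expR.
have dt A :
    has_sum (d A) (charfun p v - \sum_(a <- A) charfun_fps p a * mpow v a).
  apply: has_sumB.
    have H := @has_sum_charfun _ _ u _ siegelB v.
    by rewrite /charfun /Exp (has_sum_csum H); exact: H.
  have H a : has_sum (fun n => 'i%C ^+ mdeg a / (mfact a)%:R * mpow v a
        * Eterm p (monomial R a) n)
      (charfun_fps p a * mpow v a).
    rewrite /charfun_fps [X in has_sum _ X]mulrAC; apply: has_sumZ.
    rewrite /moment ExpE //; last exact: exp_growth_monomial.
    by apply: has_sum_Eterm => //; exact: exp_growth_monomial.
  apply: eq_has_sum (@has_sum_sum _ _ _ A _ _ H) => n.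
  rewrite /Eterm /T mulr_suml; apply: eq_bigr => a _.
  by rewrite prod_exp_term mulrA.
apply/cvg_normcP => e e0.
have := @has_sum_dominated_cvg0 _ R _ (@totally (mindex g)) _ d _ G M
  hM dG _ dt e e0.
under eq_near do rewrite -partial_sumE.
apply=> n e1 e10.
(* Pointwise convergence of [d] remains; adding 1 turns the modulus of [p n] into a positive
   divisor. *)
have q0 : 0 < normc (p n) + 1 by rewrite ltr_wpDl ?normc_ge0.
have /cvg_normcP/(_ _ (divr_gt0 e10 q0)) := @has_sum_exp_mindex _ _ (z n).
apply: filterS => A; rewrite partial_sumE -expcharE -/(T A n).
rewrite ltr_pdivlMr // => hA.
rewrite /d /Eterm -mulrBl normcM; apply: le_lt_trans hA.
by rewrite ler_wpM2l ?normc_ge0 // lerDl.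
Qed.

End CharacteristicFunction.

(** * Characteristic function, moments and cumulants of the discrete Gaussian *)

Theorem proposition4p1 (R : realType) (g : nat) (hg : (0 < g)%N)
    (u : 'cV[R[i]]_g) (B : 'M[R[i]]_g)
    (hB : siegel B) (hu : ~ Theta (u, B)) :
  let th : 'cV[R[i]]_g -> R[i] := fun w => theta w B in
  let p : 'cV[int]_g -> R[i] := dgauss u B in
  let twopi : R[i] := (2 * pi)%:C in
  let phi_coef : mindex g -> R[i] := fun a =>
    (th u)^-1 * ('i%C ^+ mdeg a / twopi ^+ mdeg a) * (mfact a)%:R^-1
      * Dmulti a th u in
  (* the characteristic function, as a function of v *)
  (forall v : 'cV[R[i]]_g,
     [/\ is_summable (Eterm p (expchar v)),
         charfun p v = th (u + ('i%C / twopi) *: v) / th u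
       & has_sum (fun a : mindex g => phi_coef a * mpow v a) (charfun p v)]) /\
  (* the characteristic function, as a formal power series in v *)
  (forall a : mindex g,
     charfun_fps p a
       = taylor_fps (fun v => th (u + ('i%C / twopi) *: v) / th u) a /\
     charfun_fps p a = phi_coef a) /\
  (* moments *)
  (forall a : mindex g,
     is_summable (Eterm p (monomial R a)) /\
     moment p a = (twopi ^+ mdeg a)^-1 * (th u)^-1 * Dmulti a th u) /\
  (* central moments *)
  (forall a : mindex g,
     is_summable (Eterm p (cmonomial p a)) /\
     cmoment p a
       = (twopi ^+ mdeg a)^-1 * (th u)^-1 *
         \sum_(b \in [set b : mindex g | mle b a])
           (mbinom R[i] a b * ((-1) ^+ mdeg b / th u ^+ mdeg b)
             * mpow (grad th u) b * Dmulti (msub a b) th u)) /\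
  (* cumulants *)
  (forall a : mindex g, a <> @mindex0 g ->
     cumulant p a = (twopi ^+ mdeg a)^-1 * Dlog a th u).
Proof.
move=> th p twopi phi_coef.
have th0 : th u != 0 by apply/eqP => thu; apply: hu.
have tp0 : twopi != 0 by exact: twopi_neq0.
have i0 : 'i%C != 0 :> R[i] by rewrite eq_complex /= oner_eq0 andbF.
have thV0 : (th u)^-1 != 0 by rewrite invr_eq0.
have coefE a : charfun_fps p a = phi_coef a.
  by rewrite /charfun_fps momentE // /phi_coef -/twopi -/th; ring.
split; [|split; [|split; [|split]]].
- move=> v; have H := @has_sum_charfun _ _ u _ hB v; split.
  + by eexists; exact: H.
  + exact: has_sum_csum H.
  + under eq_fun do rewrite -coefE.
    exact: has_sum_charfun_fps.
(* The function of [v] is an affine pullback of theta with factor [(th u)^-1] and slope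
   [i / (2 pi)], so its derivatives at 0 are scaled derivatives of theta at [u]. *)
- move=> a; split=> //; rewrite coefE /taylor_fps.
  under [X in Dmulti _ X]eq_fun do rewrite mulrC.
  rewrite Dmulti_affine ?mulf_neq0 ?invr_eq0 // scaler0 addr0 expr_div_n.
  rewrite /phi_coef; ring.
- move=> a; split; last exact: momentE.
  by eexists; apply: has_sum_Eterm => //; exact: exp_growth_monomial.
- move=> a; have H := @has_sum_cmonomial _ _ u _ hB th0 a.
  split; last exact: has_sum_csum H.
  by eexists; exact: H.
- move=> a _; rewrite /cumulant.
  (* The moment generating function is theta along [v |-> u + v / (2 pi)], divided by the constant
     [th u], which logarithmic derivatives do not see. *)
  have -> : mgf p = fun v => (th u)^-1 * th (u + twopi^-1 *: v).
    by apply/funext => v; apply: has_sum_csum; exact: has_sum_expmgf.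
  by rewrite Dlog_affine ?invr_eq0 // scaler0 addr0 exprVn.
Qed.
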